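(* Let $R$ be a commutative Noetherian ring with nonzero identity, let $I$ and $J$ be ideals of $R$, let $M$ be an $R$-module, let $s$ and $t$ be integers, and let $N$ be an $(I,J)$-torsion $R$-module. Suppose that - $\operatorname{Ext}_R^{s+t-i}(N,H^{i}_{I,J}(M))=0$ for all $i\neq t$ with $i\leq s+t$, - $\operatorname{Ext}_R^{s+t+1-i}(N,H^{i}_{I,J}(M))=0$ for all $i<t$, and - $\operatorname{Ext}_R^{s+t-1-i}(N,H^{i}_{I,J}(M))=0$ for all $t<i<s+t$. Then $$\operatorname{Ext}_R^{s}(N,H^{t}_{I,J}(M))\cong\operatorname{Ext}_R^{s+t}(N,M).$$
   Context: Modules are not assumed finitely generated. Let $W(I,J)=\{\mathfrak p\in\operatorname{Spec}(R): I^n\subseteq J+\mathfrak p \text{ for some positive integer } n\}$. For an $R$-module $M$, $\Gamma_{I,J}(M)=\{x\in M:\operatorname{Supp}_R(Rx)\subseteq W(I,J)\}$ is the $(I,J)$-torsion submodule of $M$; a module $N$ is $(I,J)$-torsion if $\Gamma_{I,J}(N)=N$. The functor $\Gamma_{I,J}(-)$ is a covariant $R$-linear functor from $R$-modules to $R$-modules, and $H^i_{I,J}(-)$ denotes its $i$-th right derived functor (the $i$-th local cohomology functor with respect to $(I,J)$). Ext modules and local cohomology modules in negative degrees are zero. *)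

(* Defs.v *)
From HB Require Import structures.
From mathcomp Require Import all_boot all_order all_algebra ring_quotient.
From mathcomp Require Import all_classical.

Set Implicit Arguments.
Unset Strict Implicit.
Unset Printing Implicit Defensive.

Import GRing.Theory Num.Theory.

Local Open Scope classical_set_scope.
Local Open Scope ring_scope.
Local Open Scope quotient_scope.

(* Throughout, submodules of an R-module V are the bool-valued predicates with
   a [submodClosed V] structure; predicates defined by a Prop go through the
   classical reflection `[< _ >]. *)

Section LinearMaps.
Variable R : comNzRingType.

Definition mk_linear (U V : lmodType R) (f : U -> V) (lf : linear f) :
  {linear U -> V} := HB.pack f (GRing.isLinear.Build R U V *:%R f lf).

Lemma linear_eq (U V : lmodType R) (f g : {linear U -> V}) :
  f =1 g -> f = g.
Proof.
case: f g => [f cf] [g cg] /= fg.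
have {}fg : f = g by apply/funext.
subst g; case: cf cg => [[a] [b]] [[a'] [b']].
by rewrite (Prop_irrelevance a a') (Prop_irrelevance b b').
Qed.

Definition zero_module (M : lmodType R) : Prop := forall x : M, x = 0.

Definition module_iso (M N : lmodType R) : Prop :=
  exists f : {linear M -> N}, bijective f.

End LinearMaps.

Section SubQuotient.
Variables (R : comNzRingType) (V : lmodType R).

Definition submod (S : submodClosed V) := {x : V | x \in S}.

HB.instance Definition _ S := SubChoice.on (submod S).
HB.instance Definition _ (S : submodClosed V) :=
  [SubChoice_isSubLmodule of submod S by <:].

Definition mk_submod (S : submodClosed V) (x : V) (Sx : x \in S) : submod S :=
  exist _ x Sx.

(* A [submodClosed] predicate is only declared closed under addition and
   scaling, whereas the quotients of the library need a [zmodClosed] one. *)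
Definition zmod_of (S : submodClosed V) : {pred V} := [pred x | x \in S].

Lemma zmod_of_closed (S : submodClosed V) : zmod_closed (zmod_of S).
Proof.
split=> [|x y]; rewrite !inE; first exact: rpred0.
by move=> Sx Sy; rewrite rpredD // -scaleN1r rpredZ.
Qed.

HB.instance Definition _ (S : submodClosed V) :=
  GRing.isZmodClosed.Build V (zmod_of S) (zmod_of_closed S).

Definition quotmod (S : submodClosed V) := Quotient.quot (zmod_of S).

HB.instance Definition _ (S : submodClosed V) := GRing.Zmodule.on (quotmod S).

Definition quot_pi (S : submodClosed V) (x : V) : quotmod S :=
  \pi_(Quotient.quot (zmod_of S)) x.

Lemma quot_piP (S : submodClosed V) (x y : V) :
  quot_pi S x = quot_pi S y <-> x - y \in S.
Proof.
have -> : (x - y \in S) = (x - y \in zmod_of S) by rewrite inE.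
by rewrite Quotient.idealrBE; split=> /eqP.
Qed.

Lemma quot_pi_surj (S : submodClosed V) (u : quotmod S) :
  exists x, u = quot_pi S x.
Proof. by exists (repr (u : Quotient.quot (zmod_of S))); rewrite /quot_pi reprK. Qed.

Lemma quot_piD (S : submodClosed V) : {morph quot_pi S : x y / x + y}.
Proof. by move=> x y; rewrite /quot_pi raddfD. Qed.

Definition quot_scale (S : submodClosed V) (a : R) (u : quotmod S) : quotmod S :=
  quot_pi S (a *: repr (u : Quotient.quot (zmod_of S))).

Lemma quot_scaleE (S : submodClosed V) a x :
  quot_scale a (quot_pi S x) = quot_pi S (a *: x).
Proof.
apply/quot_piP; rewrite -scalerBr rpredZ //; apply/quot_piP.
by rewrite /quot_pi reprK.
Qed.

Section QuotientLmodule.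
Variable S : submodClosed V.

Fact quot_scaleA a b (u : quotmod S) :
  quot_scale a (quot_scale b u) = quot_scale (a * b) u.
Proof. by have [x ->] := quot_pi_surj u; rewrite !quot_scaleE scalerA. Qed.

Fact quot_scale1 : left_id 1 (@quot_scale S).
Proof. by move=> u; have [x ->] := quot_pi_surj u; rewrite quot_scaleE scale1r. Qed.

Fact quot_scaleDr : right_distributive (@quot_scale S) +%R.
Proof.
move=> a u v; have [x ->] := quot_pi_surj u; have [y ->] := quot_pi_surj v.
by rewrite -quot_piD !quot_scaleE scalerDr quot_piD.
Qed.

Fact quot_scaleDl u : {morph (@quot_scale S)^~ u : a b / a + b}.
Proof.
by move=> a b; have [x ->] := quot_pi_surj u; rewrite !quot_scaleE scalerDl quot_piD.
Qed.

HB.instance Definition _ := GRing.Zmodule_isLmodule.Build R (quotmod S)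
  quot_scaleA quot_scale1 quot_scaleDr quot_scaleDl.

Fact quot_pi_linear : linear (quot_pi S).
Proof. by move=> a x y; rewrite quot_piD -quot_scaleE. Qed.

HB.instance Definition _ :=
  GRing.isLinear.Build R V (quotmod S) *:%R (quot_pi S) quot_pi_linear.

End QuotientLmodule.
End SubQuotient.

Section KernelImage.
Variables (R : comNzRingType) (U V : lmodType R) (f : {linear U -> V}).

Definition ker_pred : {pred U} := [pred x | f x == 0].

Fact ker_pred_closed : submod_closed ker_pred.
Proof.
split=> [|a x y]; rewrite !inE ?linear0 // => /eqP fx /eqP fy.
by rewrite linearP fx fy scaler0 addr0.
Qed.

HB.instance Definition _ :=
  GRing.isSubmodClosed.Build R U ker_pred ker_pred_closed.

Definition im_pred : {pred V} := [pred y | `[< exists x, y = f x >]].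

Fact im_pred_closed : submod_closed im_pred.
Proof.
split=> [|a x y]; rewrite !inE; first by exists 0; rewrite linear0.
move=> [u ->] [v ->].
by exists (a *: u + v); rewrite linearP.
Qed.

HB.instance Definition _ :=
  GRing.isSubmodClosed.Build R V im_pred im_pred_closed.

End KernelImage.

Section Complexes.
Variable R : comNzRingType.

(* Cochain complexes concentrated in nonnegative degrees. *)
Record cochain := Cochain {
  cobj :> nat -> lmodType R;
  cdiff : forall n, {linear cobj n -> cobj n.+1};
  cdiff_cdiff : forall n (x : cobj n), cdiff n.+1 (cdiff n x) = 0
}.

Definition cocycles (C : cochain) (n : nat) : submodClosed (C n) :=
  ker_pred (cdiff C n).

Definition is_coboundary (C : cochain) (n : nat) : C n -> Prop :=
  match n return C n -> Prop with
  | 0 => fun z => z = 0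
  | m.+1 => fun z => exists y : C m, z = cdiff C m y
  end.

Definition coboundaries (C : cochain) (n : nat) :
    {pred submod (cocycles C n)} :=
  [pred z | `[< is_coboundary (val z) >]].
Arguments coboundaries : clear implicits.

Fact coboundaries_closed C n : submod_closed (coboundaries C n).
Proof.
case: n => [|n]; split=> [|a x y]; rewrite !inE //=.
- by move=> x0 y0; rewrite x0 y0 scaler0 addr0.
- by exists 0; rewrite linear0.
- move=> [u xu] [v yv].
  by exists (a *: u + v); rewrite /= linearP -xu -yv.
Qed.

HB.instance Definition _ C n :=
  GRing.isSubmodClosed.Build R _ (coboundaries C n) (@coboundaries_closed C n).

Definition cohomology (C : cochain) (n : nat) : lmodType R :=
  quotmod (coboundaries C n).

End Complexes.

Section InjectiveResolutions.
Variable R : comNzRingType.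

Definition injective_module (E : lmodType R) : Prop :=
  forall (A B : lmodType R) (i : {linear A -> B}) (f : {linear A -> E}),
    injective i -> exists g : {linear B -> E}, forall a, g (i a) = f a.

Record injective_resolution (M : lmodType R) := InjectiveResolution {
  ires :> cochain R;
  ires_aug : {linear M -> ires 0%N};
  ires_injective : forall n, injective_module (ires n);
  ires_aug_inj : injective ires_aug;
  ires_exact0 : forall x : ires 0%N,
    cdiff ires 0 x = 0 <-> exists m, x = ires_aug m;
  ires_exact : forall n (x : ires n.+1),
    cdiff ires n.+1 x = 0 <-> exists y, x = cdiff ires n y
}.

End InjectiveResolutions.

(* Enough injectives: M embeds in Hom_Z(R, D^X), where D = Q/Z and X is the
   set of additive maps M -> D. *)

Section DivisibleGroups.

Definition divisible (D : zmodType) : Prop :=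
  forall (n : nat) (x : D), (0 < n)%N -> exists y, y *+ n = x.

Definition partial_hom (B D : zmodType) (G : set (B * D)) : Prop :=
  [/\ G 0, forall u v, G u -> G v -> G (u - v) & forall d, G (0, d) -> d = 0].

Lemma partial_hom_opp (B D : zmodType) (G : set (B * D)) u :
  partial_hom G -> G u -> G (- u).
Proof. by case=> G0 GB _ Gu; rewrite -sub0r; exact: GB. Qed.

Lemma partial_hom_add (B D : zmodType) (G : set (B * D)) u v :
  partial_hom G -> G u -> G v -> G (u + v).
Proof.
move=> pG Gu Gv; rewrite -[v]opprK; case: (pG) => _ GB _; apply: GB => //.
exact: partial_hom_opp.
Qed.

Lemma partial_hom_mul (B D : zmodType) (G : set (B * D)) b d (k : int) :
  partial_hom G -> G (b, d) -> G (b *~ k, d *~ k).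
Proof.
move=> pG Gbd.
have Gn n : G (b *+ n, d *+ n).
  elim: n => [|n IHn]; first by rewrite !mulr0n; case: pG.
  by rewrite !mulrS; exact: (partial_hom_add pG Gbd IHn).
case: k => n; first exact: Gn.
by rewrite !NegzE !mulrNz; exact: (partial_hom_opp pG (Gn _)).
Qed.

Lemma partial_hom_fun (B D : zmodType) (G : set (B * D)) b d d' :
  partial_hom G -> G (b, d) -> G (b, d') -> d = d'.
Proof.
move=> [_ GB Gf] Gd Gd'; apply/eqP; rewrite -subr_eq0; apply/eqP/Gf.
by rewrite -(subrr b); exact: (GB (b, d) (b, d')).
Qed.

Lemma partial_hom_step (B D : zmodType) (G : set (B * D)) (b : B) :
  divisible D -> partial_hom G ->
  exists d, forall (k : int) e, G (b *~ k, e) -> e = d *~ k.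
Proof.
move=> divD pG.
pose P n := (0 < n)%N && `[< exists e, G (b *+ n, e) >].
have [[n Pn]|noP] := pselect (exists n, P n); last first.
  exists 0 => k e Gk; rewrite mul0rz.
  have [k0|k0] := eqVneq k 0.
    by move: Gk; rewrite k0 mulr0z; case: pG => _ _; apply.
  case: noP; exists `|k|%N; rewrite /P absz_gt0 k0 /=; apply/asboolP.
  case: k Gk k0 => m Gk _; first by exists e.
  exists (- e); have := partial_hom_opp pG Gk.
  by rewrite NegzE mulrNz -[- (_, e)]/(- - _, - e) opprK.
case: (ex_minnP (ex_intro _ n Pn)) => m /andP[m0 /asboolP[e0 Ge0]] minm.
have [d dm] := divD m e0 m0; exists d => k e Gk.
have kE := divz_eq k m%:Z.
have r0 : (k %% m%:Z)%Z = 0.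
  apply/eqP; rewrite -absz_eq0; apply: contraT => nz.
  have r_ge0 : 0 <= (k %% m%:Z)%Z by rewrite modz_ge0 // -lt0n.
  have : (m <= `|(k %% m%:Z)%Z|)%N.
    apply: minm; rewrite /P lt0n nz /=; apply/asboolP.
    exists (e - e0 *~ (k %/ m%:Z)%Z).
    have GG : G (b *~ k - (b *+ m) *~ (k %/ m%:Z)%Z, e - e0 *~ (k %/ m%:Z)%Z).
      case: (pG) => _ GB _.
      exact: (GB (_, _) (_, _) Gk (partial_hom_mul _ pG Ge0)).
    suff <- : b *~ k - (b *+ m) *~ (k %/ m%:Z)%Z = b *+ `|(k %% m%:Z)%Z| by [].
    rewrite pmulrn -mulrzA -mulrzBr [b *+ `|_|]pmulrn gez0_abs //.
    by congr (_ *~ _); rewrite [X in X - _]kE [m%:Z * _]mulrC addrAC subrr add0r.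
  by rewrite leqNgt -ltz_nat gez0_abs // ltz_pmod.
move: Gk; rewrite kE r0 addr0 => Gk.
apply: (partial_hom_fun pG Gk).
have := partial_hom_mul (k %/ m%:Z)%Z pG Ge0.
by rewrite -dm !pmulrn -!mulrzA ![m%:Z * _]mulrC.
Qed.

Lemma partial_hom_extend (B D : zmodType) (G0 : set (B * D)) :
  divisible D -> partial_hom G0 ->
  exists2 g : B -> D, {morph g : x y / x + y} &
    forall b d, G0 (b, d) -> g b = d.
Proof.
move=> divD pG0.
pose P (G : set (B * D)) := G = set0 \/ (partial_hom G /\ G0 `<=` G).
have [F FP Ftot|G [PG maxG]] := @Zorn_bigcup _ P.
  have [[X0 FX0 [z X0z]]|noX] := pselect (exists2 X, F X & X !=set0); last first.
    left; apply/seteqP; split=> // z [X FX Xz].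
    by case: noX; exists X => //; exists z.
  have good X z' : F X -> X z' -> partial_hom X /\ G0 `<=` X.
    by move=> FX Xz'; case: (FP X FX) => // X0'; move: Xz'; rewrite X0'.
  right; split; last first.
    by move=> w G0w; exists X0 => //; apply: (good _ _ FX0 X0z).2.
  split.
  - by exists X0 => //; case: (good _ _ FX0 X0z).1.
  - move=> u v [X FX Xu] [Y FY Yv]; case: (Ftot _ _ FX FY) => XY.
      exists Y => //; case: (good _ _ FY Yv).1 => _ + _; apply=> //; exact: XY.
    exists X => //; case: (good _ _ FX Xu).1 => _ + _; apply=> //; exact: XY.
  - by move=> d [X FX Xd]; case: (good _ _ FX Xd).1 => _ _; apply.
have [pG G0G] : partial_hom G /\ G0 `<=` G.
  case: PG => // GE; exfalso; apply: (maxG G0); last by right; split.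
  by rewrite GE; split=> // G00; case: pG0 => /G00.
have totG b : exists d, G (b, d).
  apply: contrapT => nob.
  have [d dP] := partial_hom_step b divD pG.
  pose G' : set (B * D) :=
    [set z | exists w k, G w /\ z = (w.1 + b *~ k, w.2 + d *~ k)].
  have GG' : G `<=` G'.
    by move=> w Gw; exists w, 0; split=> //; rewrite !mulr0z !addr0; case: w Gw.
  apply: (maxG G').
    split=> // G'G; apply: nob; exists d; apply: G'G; exists 0, 1.
    by split; [case: pG | rewrite !mulr1z !add0r].
  right; split; last by apply: subset_trans GG'.
  split; first by apply: GG'; case: pG.
  - move=> _ _ [w [k [Gw ->]]] [w' [k' [Gw' ->]]]; exists (w - w'), (k - k').
    split; first by case: pG => _ + _; apply.
    congr pair; rewrite /= mulrzBr opprD addrACA //.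
  - move=> e [[x y] [k [Gw [/esym xk ->]]]]; rewrite /= in xk *.
    have Gk : G (b *~ (- k), y).
      by rewrite mulrNz -[- _]addr0 -xk addrC addrK.
    by rewrite (dP _ _ Gk) mulrNz addNr.
pose g b := sval (cid (totG b)).
have gP b : G (b, g b) by rewrite /g; case: cid.
exists g => [x y|b d G0d]; last exact: (partial_hom_fun pG (gP b) (G0G _ G0d)).
exact: (partial_hom_fun pG (gP _) (partial_hom_add pG (gP x) (gP y))).
Qed.

Definition int_rat : {pred rat} := [pred x | x \is a Num.int].

Fact int_rat_closed : zmod_closed int_rat.
Proof. by split=> [|x y]; rewrite !inE ?rpred0 //; apply: rpredB. Qed.

HB.instance Definition _ := GRing.isZmodClosed.Build rat int_rat int_rat_closed.

Definition rat_mod_int : zmodType := Quotient.quot int_rat.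

Definition rat_pi (x : rat) : rat_mod_int := \pi_(Quotient.quot int_rat) x.

Lemma rat_piMn x n : rat_pi (x *+ n) = rat_pi x *+ n.
Proof. by rewrite /rat_pi raddfMn. Qed.

Lemma rat_pi_eq0 x : rat_pi x = 0 <-> x \is a Num.int.
Proof.
have -> : (0 : rat_mod_int) = rat_pi 0 by rewrite /rat_pi raddf0.
have -> : (x \is a Num.int) = (x - 0 \in int_rat) by rewrite subr0 inE.
by rewrite Quotient.idealrBE; split=> /eqP.
Qed.

Lemma divisible_rat_mod_int : divisible rat_mod_int.
Proof.
move=> n x n0; rewrite -[x]reprK; exists (rat_pi (repr x / n%:R)).
by rewrite -rat_piMn -[_ / _ *+ _]mulr_natr divfK // pnatr_eq0 -lt0n.
Qed.

Lemma divisible_fun (X : Type) (D : zmodType) :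
  divisible D -> divisible (X -> D).
Proof.
move=> divD n f n0; have hf x : exists y, y *+ n = f x by exact: divD.
exists (fun x => sval (cid (hf x))); apply/funext => x.
rewrite -[RHS](svalP (cid (hf x))).
have mulrn_app m (h : X -> D) : (h *+ m) x = h x *+ m.
  by elim: m => [|m IHm]; rewrite ?mulr0n // !mulrS -IHm.
exact: mulrn_app.
Qed.

Lemma rat_mod_int_separates (M : zmodType) (m : M) : m != 0 ->
  exists2 g : M -> rat_mod_int, {morph g : x y / x + y} & g m != 0.
Proof.
move=> m0.
pose P n := (0 < n)%N && (m *+ n == 0).
have [c c0 cP] : exists2 c : rat_mod_int, c != 0 &
    forall k : int, m *~ k = 0 -> c *~ k = 0.
  have inv_nz n : (1 < n)%N -> rat_pi (n%:R^-1) != 0.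
    move=> n1; apply/eqP => /rat_pi_eq0 /intrP[z zE].
    have n0 : (0 : rat) < n%:R by rewrite ltr0n (ltn_trans _ n1).
    have z0 : (0 : rat) < z%:~R by rewrite -zE invr_gt0.
    have z1 : z%:~R < 1 :> rat by rewrite -zE invf_lt1 // ltr1n.
    by move: z0 z1; rewrite ltr0z ltrz1; case: (z) => // -[].
  have [[n Pn]|noP] := pselect (exists n, P n); last first.
    exists (rat_pi (2%:R^-1)); first exact: inv_nz.
    move=> k mk; have [->|k0] := eqVneq k 0; first by rewrite mulr0z.
    case: noP; exists `|k|%N; rewrite /P absz_gt0 k0 /=.
    by case: k mk {k0} => n /eqP //; rewrite NegzE mulrNz oppr_eq0.
  case: (ex_minnP (ex_intro _ n Pn)) => q /andP[q0 /eqP mq] minq.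
  have q1 : (1 < q)%N.
    by case: q q0 mq {minq} => [|[|q]] // _ mq; move: m0; rewrite -mq mulr1n eqxx.
  exists (rat_pi (q%:R^-1)); first exact: inv_nz.
  move=> k mk.
  have qc : rat_pi (q%:R^-1) *+ q = 0.
    rewrite -rat_piMn -[_^-1 *+ _]mulr_natr mulVf ?pnatr_eq0 -?lt0n //.
    exact/rat_pi_eq0/rpred1.
  have kE := divz_eq k q%:Z.
  have mr : m *~ (k %% q%:Z)%Z = 0.
    by move: mk; rewrite {1}kE mulrzDr [_ * q%:Z]mulrC mulrzA -pmulrn mq mul0rz add0r.
  have r_ge0 : 0 <= (k %% q%:Z)%Z by rewrite modz_ge0 // -lt0n.
  have r0 : (k %% q%:Z)%Z = 0.
    apply/eqP; rewrite -absz_eq0; apply: contraT => nz.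
    have : (q <= `|(k %% q%:Z)%Z|)%N.
      by apply: minq; rewrite /P lt0n nz /= pmulrn gez0_abs // mr.
    by rewrite leqNgt -ltz_nat gez0_abs // ltz_pmod.
  by rewrite kE r0 addr0 mulrC mulrzA -pmulrn qc mul0rz.
pose G : set (M * rat_mod_int) := [set z | exists k : int, z = (m *~ k, c *~ k)].
have pG : partial_hom G.
  split.
  - by exists 0; rewrite !mulr0z.
  - move=> _ _ [k ->] [l ->]; exists (k - l); rewrite !mulrzBr //.
  - by move=> d [k [/esym mk ->]]; exact: cP.
have [g gD gG] := partial_hom_extend divisible_rat_mod_int pG.
exists g => //; rewrite (gG m c) //; exists 1; by rewrite !mulr1z.
Qed.

End DivisibleGroups.

Section Coinduced.
Variables (R : comNzRingType) (D : zmodType).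

Definition additive_pred : {pred (R -> D)} :=
  [pred h : R -> D | `[< {morph h : x y / x + y} >]].

Fact additive_pred_closed : zmod_closed additive_pred.
Proof.
split=> [|f g]; rewrite !inE.
  by move=> x y; rewrite /= addr0.
move=> fD gD x y.
by rewrite /GRing.add /GRing.opp /= fD gD opprD addrACA.
Qed.

HB.instance Definition _ :=
  GRing.isZmodClosed.Build (R -> D) additive_pred additive_pred_closed.

Definition coind := {h : R -> D | h \in additive_pred}.
HB.instance Definition _ := SubChoice.on coind.
HB.instance Definition _ := [SubChoice_isSubZmodule of coind by <:].

Definition mk_coind (h : R -> D) (hP : h \in additive_pred) : coind :=
  exist _ h hP.

Lemma coindD (h : coind) : {morph val h : x y / x + y}.
Proof. by case: h => h hP /=; move: (hP); rewrite inE. Qed.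

Fact coind_scale_subproof (a : R) (h : coind) :
  (fun r => val h (r * a)) \in additive_pred.
Proof. by rewrite inE => x y /=; rewrite mulrDl coindD. Qed.

Definition coind_scale (a : R) (h : coind) : coind :=
  mk_coind (coind_scale_subproof a h).

Lemma coind_eq (h k : coind) : val h =1 val k -> h = k.
Proof. by move=> hk; apply/val_inj/funext. Qed.

Fact coind_scaleA a b h : coind_scale a (coind_scale b h) = coind_scale (a * b) h.
Proof. by apply: coind_eq => r /=; rewrite mulrA. Qed.
Fact coind_scale1 : left_id 1 coind_scale.
Proof. by move=> h; apply: coind_eq => r /=; rewrite mulr1. Qed.
Fact coind_scaleDr : right_distributive coind_scale +%R.
Proof. by move=> a h k; apply: coind_eq. Qed.
Fact coind_scaleDl h : {morph coind_scale^~ h : a b / a + b}.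
Proof. by move=> a b; apply: coind_eq => r /=; rewrite mulrDr coindD. Qed.

HB.instance Definition _ := GRing.Zmodule_isLmodule.Build R coind
  coind_scaleA coind_scale1 coind_scaleDr coind_scaleDl.

Lemma coind_injective : divisible D -> injective_module coind.
Proof.
move=> divD A B i f inji.
pose G : set (B * D) := [set z | exists a : A, z = (i a, val (f a) 1)].
have pG : partial_hom G.
  split.
  - by exists 0; rewrite !linear0.
  - by move=> _ _ [a ->] [b ->]; exists (a - b); rewrite !linearB.
  - move=> d [a [/esym ia ->]].
    by have -> : a = 0; [apply: inji; rewrite ia linear0|rewrite linear0].
have [g gD gG] := partial_hom_extend divD pG.
have gP b : (fun r => g (r *: b)) \in additive_pred.
  by rewrite inE => x y; rewrite scalerDl gD.
have lg : linear (fun b => mk_coind (gP b)).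
  move=> a x y; apply: coind_eq => r /=.
  by rewrite scalerDr gD scalerA.
exists (mk_linear lg) => a; apply: coind_eq => r /=.
rewrite (gG _ (val (f (r *: a)) 1)); last by exists (r *: a); rewrite [i (_ *: _)]linearZ.
by rewrite linearZ /= mul1r.
Qed.

End Coinduced.

Section EnoughInjectives.
Variables (R : comNzRingType) (M : lmodType R).

Definition characters := {g : M -> rat_mod_int | {morph g : x y / x + y}}.

Definition inj_hull : lmodType R := coind R (characters -> rat_mod_int).

Lemma inj_hull_injective : injective_module inj_hull.
Proof. exact/coind_injective/divisible_fun/divisible_rat_mod_int. Qed.

Fact inj_hull_map_subproof (m : M) :
  (fun r (g : characters) => sval g (r *: m)) \in
    @additive_pred R (characters -> rat_mod_int).
Proof.
rewrite inE => x y; apply/funext => g /=.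
by rewrite scalerDl (svalP g).
Qed.

Definition inj_hull_map (m : M) : inj_hull :=
  mk_coind (inj_hull_map_subproof m).

Fact inj_hull_map_linear : linear inj_hull_map.
Proof.
move=> a x y; apply: coind_eq => r; apply/funext => g /=.
by rewrite scalerDr (svalP g) scalerA.
Qed.

HB.instance Definition _ :=
  GRing.isLinear.Build R M inj_hull *:%R inj_hull_map inj_hull_map_linear.

Lemma inj_hull_map_inj : injective inj_hull_map.
Proof.
suff ker0 m : inj_hull_map m = 0 -> m = 0.
  move=> x y xy; apply/eqP; rewrite -subr_eq0; apply/eqP/ker0.
  by rewrite linearB /= xy subrr.
move=> m0; apply/eqP; apply: contraT => /rat_mod_int_separates[g gD /eqP[]].
have /(congr1 (fun h : inj_hull => val h 1 (exist _ g gD))) := m0.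
by rewrite /= scale1r.
Qed.

End EnoughInjectives.

Theorem enough_injectives (R : comNzRingType) (M : lmodType R) :
  exists (E : lmodType R) (i : {linear M -> E}),
    injective_module E /\ injective i.
Proof.
exists (inj_hull M), (@inj_hull_map R M).
by split; [exact: inj_hull_injective | exact: inj_hull_map_inj].
Qed.

Section StandardResolution.
Variables (R : comNzRingType) (M : lmodType R).

Definition cosyzygy : nat -> lmodType R :=
  fix K n := if n is m.+1
    then quotmod (im_pred (@inj_hull_map R (K m))) : lmodType R else M.

Definition res_obj (n : nat) : lmodType R := inj_hull (cosyzygy n).

Definition res_aug n : {linear cosyzygy n -> res_obj n} :=
  @inj_hull_map R (cosyzygy n).

Definition res_proj n : {linear res_obj n -> cosyzygy n.+1} :=
  quot_pi (im_pred (@inj_hull_map R (cosyzygy n))).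

Definition res_diff n : {linear res_obj n -> res_obj n.+1} :=
  res_aug n.+1 \o res_proj n.

Lemma res_proj_eq0 n x : res_proj n x = 0 <-> exists m, x = res_aug n m.
Proof.
have -> : 0 = res_proj n 0 by rewrite linear0.
split.
  by move/quot_piP; rewrite subr0 inE.
by move=> xE; apply/quot_piP; rewrite subr0 inE.
Qed.

Lemma res_diff_eq0 n x : res_diff n x = 0 <-> exists m, x = res_aug n m.
Proof.
rewrite -res_proj_eq0; split=> [/= |] e; last by rewrite /= e linear0.
by apply: (@inj_hull_map_inj R (cosyzygy n.+1)); rewrite linear0.
Qed.

Lemma res_exact n x : res_diff n.+1 x = 0 <-> exists y, x = res_diff n y.
Proof.
rewrite res_diff_eq0; split=> -[m ->]; last by exists (res_proj n m).
by have [y ->] := quot_pi_surj m; exists y.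
Qed.

Lemma res_diff_diff n x : res_diff n.+1 (res_diff n x) = 0.
Proof. by apply/res_exact; exists x. Qed.

(* Opaque on purpose: only the properties of an injective resolution are
   available, so nothing depends on this particular choice. *)
Lemma std_resolution : injective_resolution M.
Proof.
apply: (@InjectiveResolution R M (@Cochain R res_obj res_diff res_diff_diff)
  (res_aug 0)).
- by move=> n; exact: inj_hull_injective.
- exact: inj_hull_map_inj.
- exact: res_diff_eq0.
- exact: res_exact.
Qed.

End StandardResolution.

Section DerivedFunctors.
Variable R : comNzRingType.

(* Covariant R-linear endofunctors of the category of R-modules. *)
Record linear_functor := LinearFunctor {
  fobj :> lmodType R -> lmodType R;
  fmap : forall M N : lmodType R, {linear M -> N} -> {linear fobj M -> fobj N};
  fmap_id : forall M : lmodType R, fmap (idfun : {linear M -> M}) =1 id;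
  fmap_comp : forall (M N P : lmodType R)
    (g : {linear N -> P}) (f : {linear M -> N}),
    fmap (g \o f : {linear M -> P}) =1 fmap g \o fmap f;
  fmap_linear : forall (M N : lmodType R) (a : R) (f g : {linear M -> N}),
    fmap (a \*: f \+ g : {linear M -> N}) =1 a \*: fmap f \+ fmap g
}.

Lemma fmap0 (F : linear_functor) (M N : lmodType R) (f : {linear M -> N}) :
  f =1 (fun=> 0) -> fmap F f =1 (fun=> 0).
Proof.
move=> f0 x.
have fE : f = ((-1) \*: f \+ f : {linear M -> N}).
  by apply: linear_eq => y /=; rewrite f0 scaler0 addr0.
by rewrite fE fmap_linear /= scaleN1r addNr.
Qed.

Fact fmap_cochain_subproof (F : linear_functor) (C : cochain R) n
    (x : F (C n)) :
  fmap F (cdiff C n.+1) (fmap F (cdiff C n) x) = 0.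
Proof.
rewrite -[LHS]/((fmap F (cdiff C n.+1) \o fmap F (cdiff C n)) x) -fmap_comp.
by apply: fmap0 => y /=; rewrite cdiff_cdiff.
Qed.

Definition fmap_cochain (F : linear_functor) (C : cochain R) : cochain R :=
  @Cochain R (fun n => F (C n)) (fun n => fmap F (cdiff C n))
    (@fmap_cochain_subproof F C).

Definition right_derived (F : linear_functor) (i : int) (M : lmodType R) :
    lmodType R :=
  match i with
  | Posz n => cohomology (fmap_cochain F (std_resolution M)) n
  | Negz _ => 'rV[R]_0
  end.

End DerivedFunctors.

Section HomFunctor.
Variable R : comNzRingType.

Definition hom_pred (N M : lmodType R) : {pred (N -> M)} :=
  [pred f : N -> M | `[< linear f >]].
Arguments hom_pred : clear implicits.

Fact hom_pred_closed N M : submod_closed (hom_pred N M).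
Proof.
split=> [|c f g]; rewrite !inE.
  by move=> a x y; rewrite /= scaler0 addr0.
move=> lf lg a x y.
rewrite -[LHS]/(c *: f (a *: x + y) + g (a *: x + y)).
rewrite -[RHS]/(a *: (c *: f x + g x) + (c *: f y + g y)) lf lg.
by rewrite !scalerDr !scalerA [c * a]mulrC addrACA.
Qed.

HB.instance Definition _ (N M : lmodType R) :=
  GRing.isSubmodClosed.Build R (N -> M) (hom_pred N M) (@hom_pred_closed N M).

Definition Hom (N M : lmodType R) : lmodType R := submod (hom_pred N M).

Lemma Hom_linear N M (h : Hom N M) : linear (val h).
Proof. by case: h => h hP /=; move: (hP); rewrite inE. Qed.

Fact hom_map_subproof (N M P : lmodType R) (f : {linear M -> P}) (h : Hom N M) :
  f \o val h \in hom_pred N P.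
Proof.
by rewrite inE => a x y; rewrite /= Hom_linear linearP.
Qed.

Definition hom_map (N M P : lmodType R) (f : {linear M -> P}) (h : Hom N M) :
  Hom N P := mk_submod (hom_map_subproof f h).

Fact hom_map_linear (N M P : lmodType R) (f : {linear M -> P}) :
  linear (@hom_map N M P f).
Proof.
by move=> a g h; apply/val_inj/funext => x; rewrite /= linearP.
Qed.

Definition hom_functor (N : lmodType R) : linear_functor R.
Proof.
exists (Hom N) (fun M P f => mk_linear (@hom_map_linear N M P f)).
- by move=> M h; apply/val_inj/funext.
- by move=> M P Q g f h; apply/val_inj/funext.
- by move=> M P a f g h; apply/val_inj/funext.
Defined.

Definition Ext (i : int) (N M : lmodType R) : lmodType R :=
  right_derived (hom_functor N) i M.

End HomFunctor.

Section Ideals.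
Variable R : comNzRingType.

(* Ideals, proper or not, are the submodules of the regular module R^o (the
   [idealr] structure of the library only covers proper ideals). *)
Definition ideal := submodClosed R^o.

Definition noetherian : Prop :=
  forall I : ideal, exists (n : nat) (g : 'I_n -> R),
    [set` I] = [set \sum_(i < n) a i * g i | a in [set: 'I_n -> R]].

Definition ideal_add (A B : set R) : set R := [set a + b | a in A & b in B].

Definition ideal_mul (A B : set R) : set R :=
  [set x | exists (n : nat) (a b : 'I_n -> R),
    (forall i, A (a i) /\ B (b i)) /\ x = \sum_(i < n) a i * b i].

Definition ideal_pow (A : set R) (n : nat) : set R :=
  iter n (ideal_mul A) [set: R].

Local Notation Spec := (prime_idealr R).

Definition W_locus (I J : ideal) : set Spec :=
  [set p : Spec | exists2 n : nat, (0 < n)%N &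
    ideal_pow [set` I] n `<=` ideal_add [set` J] [set` p]].

(* Equality of the fractions f.1 / f.2 and g.1 / g.2 of the localization M_p,
   for f.2 and g.2 outside p. *)
Definition frac_eq (p : Spec) (M : lmodType R) (f g : M * R) : Prop :=
  exists2 u : R, u \notin p & u *: (g.2 *: f.1 - f.2 *: g.1) = 0.

(* The primes p such that M_p <> 0, i.e. some fraction x / s of M_p differs
   from 0 / 1. *)
Definition Supp (M : lmodType R) : set Spec :=
  [set p : Spec | exists (x : M) (s : R), s \notin p /\ ~ frac_eq p (x, s) (0, 1)].

End Ideals.

Section Torsion.
Variable R : comNzRingType.

Definition cyclic_pred (M : lmodType R) (x : M) : {pred M} :=
  [pred y | `[< exists a : R, y = a *: x >]].

Fact cyclic_pred_closed (M : lmodType R) (x : M) :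
  submod_closed (cyclic_pred x).
Proof.
split=> [|a u v]; rewrite !inE; first by exists 0; rewrite scale0r.
move=> [b ->] [c ->]; exists (a * b + c).
by rewrite scalerDl scalerA.
Qed.

HB.instance Definition _ (M : lmodType R) (x : M) :=
  GRing.isSubmodClosed.Build R M (cyclic_pred x) (cyclic_pred_closed x).

Definition cyclic_module (M : lmodType R) (x : M) : lmodType R :=
  submod (cyclic_pred x).

Lemma Supp_cyclic (M : lmodType R) (x : M) (p : prime_idealr R) :
  Supp (cyclic_module x) p <-> forall u : R, u \notin p -> u *: x <> 0.
Proof.
split.
  move=> [[y yP] [s [sp nz]]] u up ux0; apply: nz.
  exists u => //=; apply: val_inj; rewrite /= scaler0 subr0 scale1r.
  move: (yP); rewrite inE => -[a ->].
  by rewrite scalerA mulrC -scalerA ux0 scaler0.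
move=> nx.
have xP : x \in cyclic_pred x by rewrite inE; exists 1; rewrite scale1r.
exists (mk_submod xP), 1; split; first by rewrite idealr1.
by move=> [u up] /(congr1 val) /=; rewrite scaler0 subr0 scale1r; exact: nx.
Qed.

Variables I J : ideal R.

Definition Gamma_pred (M : lmodType R) : {pred M} :=
  [pred x | `[< Supp (cyclic_module x) `<=` W_locus I J >]].
Arguments Gamma_pred : clear implicits.

Fact Gamma_pred_closed (M : lmodType R) : submod_closed (Gamma_pred M).
Proof.
split=> [|a x y]; rewrite !inE.
  move=> p /Supp_cyclic /(_ 1); rewrite idealr1 scaler0.
  by move=> /(_ isT).
move=> xW yW p /Supp_cyclic xyp.
apply: contrapT => nW; have [Hx Hy] : ~ Supp (cyclic_module x) p /\
    ~ Supp (cyclic_module y) p by split=> [/xW|/yW].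
have ann (z : M) : ~ Supp (cyclic_module z) p -> exists2 u : R, u \notin p & u *: z = 0.
  move=> nS; apply: contrapT => no; apply: nS; apply/Supp_cyclic => u up uz.
  by apply: no; exists u.
have [u up ux] := ann _ Hx; have [v vp vy] := ann _ Hy.
apply: (xyp (u * v)); first by rewrite prime_idealrM negb_or up vp.
rewrite scalerDr -[(u * v) *: y]scalerA vy scaler0 addr0 scalerA.
by rewrite [_ * _ * a]mulrC [u * v]mulrC -!scalerA ux !scaler0.
Qed.

HB.instance Definition _ (M : lmodType R) :=
  GRing.isSubmodClosed.Build R M (Gamma_pred M) (@Gamma_pred_closed M).

Definition Gamma (M : lmodType R) : lmodType R := submod (Gamma_pred M).

Definition torsion (N : lmodType R) : Prop := [set` Gamma_pred N] = setT.

Fact Gamma_map_subproof (M N : lmodType R) (f : {linear M -> N}) (x : Gamma M) :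
  f (val x) \in Gamma_pred N.
Proof.
case: x => x /= xP; move: (xP); rewrite !inE => xW.
move=> p /Supp_cyclic fxp; apply: xW; apply/Supp_cyclic => u up ux.
by apply: (fxp u) => //; rewrite -linearZ ux linear0.
Qed.

Definition Gamma_map (M N : lmodType R) (f : {linear M -> N}) (x : Gamma M) :
  Gamma N := mk_submod (Gamma_map_subproof f x).

Fact Gamma_map_linear (M N : lmodType R) (f : {linear M -> N}) :
  linear (Gamma_map f).
Proof. by move=> a x y; apply/val_inj; rewrite /= linearP. Qed.

Definition Gamma_functor : linear_functor R.
Proof.
exists Gamma (fun M N f => mk_linear (@Gamma_map_linear M N f)).
- by move=> M x; apply/val_inj.
- by move=> M N P g f x; apply/val_inj.
- by move=> M N a f g x; apply/val_inj.
Defined.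

Definition local_cohomology (i : int) (M : lmodType R) : lmodType R :=
  right_derived Gamma_functor i M.

End Torsion.

(* Main.v *)
From HB Require Import structures.
From mathcomp Require Import all_boot all_order all_algebra ring_quotient.
From mathcomp Require Import all_classical.
From mathcomp Require Import zify.
Require Import Defs.

Set Implicit Arguments.
Unset Strict Implicit.
Unset Printing Implicit Defensive.

Import GRing.Theory Num.Theory.

Local Open Scope classical_set_scope.
Local Open Scope ring_scope.

(** Write [E] for an injective resolution of [M], and let [D] be the complex
    [Gamma E].  Two facts about [D] turn the theorem into homological algebra:
    - every [Gamma (E n)] is injective ([Gamma_injective]), which is where the
      Noetherian hypothesis enters;
    - [N] being torsion, every linear map [N -> E n] lands in [Gamma (E n)], so
      the complexes [Hom (N, D)] and [Hom (N, E)] have the same cohomology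
      ([torsion_hom_cohomology]).
    Thus [Ext n N M] is the cohomology of [Hom (N, D)], for a complex [D] of
    injectives whose cohomology modules are the local cohomology modules of
    [M].  What remains is a statement about any linear functor [F] and any
    complex [D] of injectives: the cohomology of [F D] is assembled from the
    derived functors of [F] at the [H^i D], and it reduces to the single piece
    [R^s F (H^t D)] when the pieces of the same total degree, and those that
    could be the source or the target of a connecting map, vanish
    ([hyperderived_collapse]).

    This would usually be read off a Grothendieck spectral sequence.  Here the
    pieces are removed one at a time from the bottom ([peel]).  An injective
    resolution [Q] of [H^0 D] maps to [D] by a chain map lifting the inclusion
    of [H^0 D] in [D 0].  The cocone of this map is a complex of injectives,
    exact in degrees 0 and 1, so two truncations leave a complex [T] of
    injectives with [H^i T = H^(i+1) D].  Since [F] commutes with cocones and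
    with split truncations, there is a long exact sequence
      [... -> R^n F (H^0 D) -> H^n (F D) -> H^(n-1) (F T) -> R^(n+1) F (H^0 D)
       -> ...],
    and the vanishing and collapsing statements follow by induction.  The same
    cocone, taken between two resolutions, is exact everywhere and shows that
    derived functors do not depend on the resolution ([right_derived_iso]).

    For the injectivity of [Gamma E], Baer's criterion leaves a linear map
    [g : a -> Gamma E] on an ideal [a] to extend to the ring.  Take an ideal
    [c] containing [ker g], and maximal such that [g] vanishes on the
    intersection of [c] and [a].  An element [x] that annihilates the image of
    [g] has a power in [c]: this is the weak form of the Artin-Rees lemma
    ([radical_of_maximal_kernel]).  Hence a prime containing [c] contains the
    annihilator of the finitely generated module [g a], and so belongs to
    [W_locus I J].  Extending [g] by 0 on [c], and then to the ring by the
    injectivity of [E], gives a map whose value at 1 is killed by [c], hence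
    lies in [Gamma E]. *)

(** * Isomorphisms and cohomology *)

Section Isomorphisms.
Variable R : comNzRingType.

Lemma module_iso_sym (M N : lmodType R) : module_iso M N -> module_iso N M.
Proof.
move=> [f [g fK gK]].
have lg : linear g.
  by move=> a x y; apply: (can_inj fK); rewrite gK linearP !gK.
by exists (mk_linear lg); exists f.
Qed.

Lemma module_iso_trans (M N P : lmodType R) :
  module_iso M N -> module_iso N P -> module_iso M P.
Proof.
by move=> [f bf] [g bg]; exists (g \o f : {linear M -> P}); apply: bij_comp.
Qed.

Lemma module_iso_zero (M N : lmodType R) :
  zero_module M -> zero_module N -> module_iso M N.
Proof.
move=> M0 N0; exists (\0 : {linear M -> N}).
by exists (fun=> 0) => x /=; rewrite ?[RHS]M0 ?[RHS]N0.
Qed.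

Lemma zero_module_iso (M N : lmodType R) :
  module_iso M N -> zero_module M -> zero_module N.
Proof. by move=> [f [g fK gK]] M0 y; rewrite -[y]gK (M0 (g y)) linear0. Qed.

Lemma zero_rV0 : zero_module ('rV[R]_0).
Proof. by move=> x; apply: thinmx0. Qed.

End Isomorphisms.

Section Cohomology.
Variable R : comNzRingType.
Implicit Types C D : cochain R.

(** In degree 0 the only coboundary is 0, so exactness there is the injectivity
    of the first differential. *)
Definition exact_at C n := forall x : C n, cdiff C n x = 0 -> is_coboundary x.

Lemma mem_cocycles C n (x : C n) : (x \in cocycles C n) = (cdiff C n x == 0).
Proof. by []. Qed.

Lemma exact_atP C n : zero_module (cohomology C n) <-> exact_at C n.
Proof.
split=> [H0 x dx|ex u].
  have xZ : x \in cocycles C n by rewrite mem_cocycles dx.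
  have /quot_piP : quot_pi (@coboundaries R C n) (mk_submod xZ) =
    quot_pi (@coboundaries R C n) 0 by rewrite [LHS]H0 [RHS]H0.
  by rewrite subr0 inE.
have [[x xZ] ->] := quot_pi_surj u.
rewrite -(linear0 (quot_pi (@coboundaries R C n))).
apply/quot_piP; rewrite subr0 inE /=; apply: ex.
by apply/eqP; rewrite -mem_cocycles.
Qed.

(** The degrees [m] and [n] may differ, so that the same criterion serves for
    quasi-isomorphisms, for degree shifts and for the maps between a complex
    and its cocone, which commute with the differentials only up to sign. *)
Lemma cohomology_iso C D m n (f : {linear C m -> D n}) :
  (forall x, cdiff C m x = 0 -> cdiff D n (f x) = 0) ->
  (forall x, cdiff C m x = 0 -> is_coboundary (f x) <-> is_coboundary x) ->
  (forall y, cdiff D n y = 0 ->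
     exists2 x, cdiff C m x = 0 & is_coboundary (f x - y)) ->
  module_iso (cohomology C m) (cohomology D n).
Proof.
move=> fZ fB fS.
have fZ' (z : submod (cocycles C m)) : f (val z) \in cocycles D n.
  case: z => z /= zZ; rewrite mem_cocycles fZ //; apply/eqP.
  by rewrite -mem_cocycles.
have zP (z : submod (cocycles C m)) : cdiff C m (val z) = 0.
  by case: z => z /= zZ; apply/eqP; rewrite -mem_cocycles.
pose g z := quot_pi (@coboundaries R D n) (mk_submod (fZ' z)).
have gE z z' : g z = g z' <->
    quot_pi (@coboundaries R C m) z = quot_pi (@coboundaries R C m) z'.
  split=> [/quot_piP|/quot_piP] h; apply/quot_piP; move: h; rewrite !inE /=.
    by move=> h; apply/fB; [rewrite linearB !zP subrr | rewrite linearB].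
  by move=> h; rewrite -linearB; apply/fB; rewrite ?linearB ?zP ?subrr.
have rep (u : cohomology C m) := cid (quot_pi_surj u).
pose h (u : cohomology C m) : cohomology D n := g (sval (rep u)).
have hE z : h (quot_pi (@coboundaries R C m) z) = g z.
  by apply/gE; rewrite -(svalP (rep _)).
have lh : linear h.
  move=> a u v; have [x ->] := quot_pi_surj u; have [y ->] := quot_pi_surj v.
  rewrite -linearP !hE /g -linearP; congr quot_pi.
  by apply: val_inj; rewrite /= linearP.
have ih : injective h.
  move=> u v; have [x ->] := quot_pi_surj u; have [y ->] := quot_pi_surj v.
  by rewrite !hE => /gE.
have sh v : exists u, h u = v.
  have [y ->] := quot_pi_surj v.
  have yZ : cdiff D n (val y) = 0.
    by case: (y) => z /= zZ; apply/eqP; rewrite -mem_cocycles.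
  have [x xZ xB] := fS _ yZ.
  have xZ' : x \in cocycles C m by rewrite mem_cocycles xZ.
  exists (quot_pi _ (mk_submod xZ')); rewrite hE.
  by apply/quot_piP; rewrite inE.
exists (mk_linear lh); exists (fun v => sval (cid (sh v))) => /= [u|v].
  by apply: ih; rewrite (svalP (cid (sh _))).
exact: (svalP (cid (sh _))).
Qed.

End Cohomology.

(** * Partial linear maps and Baer's criterion *)

(** Zorn's lemma above a given set, for properties that only nonempty chains are
    known to preserve. *)
Lemma zorn_above (T : Type) (P : set T -> Prop) (X0 : set T) :
  P X0 ->
  (forall F : set (set T), F !=set0 -> F `<=` P ->
     total_on F (fun X Y => X `<=` Y) -> P (\bigcup_(X in F) X)) ->
  exists G, [/\ X0 `<=` G, P G & forall H, G `<=` H -> P H -> H `<=` G].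
Proof.
move=> P0 PU.
have [F FP Ftot|A [PA maxA]] := @Zorn_bigcup T (fun X => P (X0 `|` X)).
  have [[X1 FX1]|noX] := pselect (F !=set0); last first.
    rewrite (_ : \bigcup_(X in F) X = set0) ?setU0 //.
    by apply/seteqP; split=> // z [X FX _]; case: noX; exists X.
  rewrite (_ : _ `|` _ = \bigcup_(Y in [set X0 `|` X | X in F]) Y).
    apply: PU; first by exists (X0 `|` X1), X1.
      by move=> _ [X FX <-]; exact: FP.
    move=> _ _ [X FX <-] [Y FY <-].
    by case: (Ftot _ _ FX FY) => XY; [left|right]; apply: setUS.
  rewrite bigcup_image; apply/seteqP; split=> [z [X0z|[X FX Xz]]|z [X FX [X0z|Xz]]].
  - by exists X1 => //; left.
  - by exists X => //; right.
  - by left.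
  - by right; exists X.
exists (X0 `|` A); split=> // H GH PH; apply: contrapT => HG.
apply: (maxA H); last by rewrite setUidr // => z X0z; apply: GH; left.
split; first by move=> z Az; apply: GH; right.
by move=> HA; apply: HG => z /HA; right.
Qed.

Section PartialLinearMaps.
Variable R : comNzRingType.
Implicit Types A B E Q : lmodType R.

(** A linear map defined on a submodule of [B], encoded by its graph: a linear
    relation is single-valued as soon as its fibre over 0 is trivial.  With
    graphs, partial maps are extended and glued without handling submodules as
    types. *)
Definition partial_linear B Q (G : set (B * Q)) : Prop :=
  [/\ G 0, forall (a : R) u v, G u -> G v -> G (a *: u + v) &
      forall q, G (0, q) -> q = 0].

Lemma partial_linear_fun B Q (G : set (B * Q)) b q q' :
  partial_linear G -> G (b, q) -> G (b, q') -> q = q'.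
Proof.
move=> [_ GL Gf] Gq Gq'; apply/eqP; rewrite -subr_eq0; apply/eqP/Gf.
have := GL (-1) _ _ Gq' Gq.
by rewrite scaleN1r addrC -[_ - _]/(b - b, q - q') subrr.
Qed.

Lemma partial_linear_total B Q (G : set (B * Q)) :
  partial_linear G -> (forall b, exists q, G (b, q)) ->
  exists g : {linear B -> Q}, forall b q, G (b, q) -> g b = q.
Proof.
move=> pG tG; pose g b := sval (cid (tG b)).
have gP b : G (b, g b) by exact: (svalP (cid (tG b))).
have lg : linear g.
  move=> a x y; apply: (partial_linear_fun pG (gP _)).
  by case: pG => _ GL _; exact: (GL a (x, g x) (y, g y)).
by exists (mk_linear lg) => b q; apply: (partial_linear_fun pG (gP b)).
Qed.

Lemma injective_extend_graph E B (G : set (B * E)) :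
  injective_module E -> partial_linear G ->
  exists g : {linear B -> E}, forall b q, G (b, q) -> g b = q.
Proof.
move=> injE pG.
pose S : {pred (B * E)} := [pred z | `[< G z >]].
have Sc : submod_closed S.
  case: pG => G0 GL _; split=> [|a u v]; rewrite !inE //.
  exact: GL.
pose Sm : submodClosed (B * E)%type :=
  HB.pack S (GRing.isSubmodClosed.Build R (B * E)%type S Sc).
pose i : submod Sm -> B := fst \o val.
pose f : submod Sm -> E := snd \o val.
have li : linear i by move=> a x y.
have lf : linear f by move=> a x y.
have ii : injective (mk_linear li).
  move=> [[b q] uG] [[b' q'] vG] /= bb; apply: val_inj => /=.
  rewrite /i /= in bb; subst b'; congr pair.
  by move: uG vG; rewrite !inE; apply: partial_linear_fun.
have [g gP] := injE _ _ (mk_linear li) (mk_linear lf) ii.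
exists g => b q Gbq; have SG : (b, q) \in Sm by rewrite inE.
exact: (gP (mk_submod SG)).
Qed.

Lemma injective_extend A B E (i : {linear A -> B}) (f : {linear A -> E}) :
  injective_module E -> (forall a, i a = 0 -> f a = 0) ->
  exists g : {linear B -> E}, forall a, g (i a) = f a.
Proof.
move=> injE kerif.
have pG : partial_linear [set z | exists a, z = (i a, f a)].
  split; first by exists 0; rewrite !linear0.
  - by move=> c _ _ [a ->] [b ->]; exists (c *: a + b); rewrite !linearP.
  - by move=> q [a [/esym ia ->]]; exact: kerif.
have [g gP] := injective_extend_graph injE pG.
by exists g => a; apply: gP; exists a.
Qed.

Lemma injective_retract E Q (j : {linear Q -> E}) (p : {linear E -> Q}) :
  cancel j p -> injective_module E -> injective_module Q.
Proof.
move=> jK injE A B i f inji.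
have [g gP] := injE _ _ i (j \o f : {linear A -> E}) inji.
by exists (p \o g : {linear B -> Q}) => a /=; rewrite gP /= jK.
Qed.

Lemma injective_prod E Q :
  injective_module E -> injective_module Q -> injective_module (E * Q)%type.
Proof.
move=> injE injQ A B i f inji.
have [g gP] := injE _ _ i (fst \o f : {linear A -> E}) inji.
have [h hP] := injQ _ _ i (snd \o f : {linear A -> Q}) inji.
have lgh : linear (fun b => (g b, h b) : (E * Q)%type).
  by move=> a x y; rewrite !linearP.
by exists (mk_linear lgh) => a /=; rewrite gP hP /=; case: (f a).
Qed.

(** Baer's criterion.  If a maximal partial extension of [f] is not defined at
    [b], then [r |-> G (r *: b)] is a partial linear map on the ring; an [e]
    representing it is a legitimate value at [b]. *)
Lemma baer Q :
  (forall G : set (R^o * Q), partial_linear G ->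
     exists e : Q, forall r q, G (r, q) -> q = r *: e) ->
  injective_module Q.
Proof.
move=> baerQ A B i f inji.
pose G0 : set (B * Q) := [set z | exists a, z = (i a, f a)].
have pG0 : partial_linear G0.
  split; first by exists 0; rewrite !linear0.
  - by move=> c _ _ [a ->] [b ->]; exists (c *: a + b); rewrite !linearP.
  - move=> q [a [/esym ia ->]].
    by rewrite (_ : a = 0) ?linear0 //; apply: inji; rewrite ia linear0.
have [F [X0 FX0] FP Ftot|G [G0G pG maxG]] := zorn_above pG0.
  split.
  - by exists X0 => //; case: (FP _ FX0).
  - move=> a u v [X FX Xu] [Y FY Yv]; case: (Ftot _ _ FX FY) => XY.
      by exists Y => //; case: (FP _ FY) => _ + _; apply=> //; exact: XY.
    by exists X => //; case: (FP _ FX) => _ + _; apply=> //; exact: XY.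
  - by move=> d [X FX Xd]; case: (FP _ FX) => _ _; apply.
have [GZ GL Gf] := pG.
have totG b : exists q, G (b, q).
  apply: contrapT => nob.
  have [e eP] : exists e : Q, forall r q, G (r *: b, q) -> q = r *: e.
    apply: (baerQ [set z : R^o * Q | G ((z.1 : R) *: b, z.2)]); split=> /=.
    - by rewrite scale0r.
    - move=> a u v Gu Gv; have := GL a _ _ Gu Gv.
      by rewrite -[a *: _ + _]/(_, _) /= scalerDl -scalerA.
    - by move=> q; rewrite scale0r; exact: Gf.
  pose G' : set (B * Q) :=
    [set z | exists w (k : R), G w /\ z = w + (k *: b, k *: e)].
  have GG' : G `<=` G'.
    move=> w Gw; exists w, 0; split=> //.
    by rewrite !scale0r -[(0, 0)]/(0 : B * Q) addr0.
  apply: nob; exists e; apply: (maxG G') => //; last first.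
    by exists 0, 1; rewrite !scale1r add0r.
  split; first exact: GG'.
  - move=> a _ _ [w [k [Gw ->]]] [w' [k' [Gw' ->]]].
    exists (a *: w + w'), (a * k + k'); split; first exact: GL.
    rewrite scalerDr addrACA; congr (_ + _).
    by rewrite !scalerDl -!scalerA.
  - move=> q [[x y] [k [Gw [/esym xk ->]]]]; rewrite /= in xk *.
    have Gk : G ((- k) *: b, y) by rewrite scaleNr -[- _]add0r -xk addrK.
    by rewrite (eP _ _ Gk) scaleNr addNr.
have [g gP] := partial_linear_total pG totG.
by exists g => a; apply: gP; apply: G0G; exists a.
Qed.

End PartialLinearMaps.

(** * Injectivity of the torsion submodule of an injective module *)

Section TorsionOfInjective.
Variables (R : comNzRingType) (I J : ideal R).

Lemma mem_Gamma (M : lmodType R) (x : M) :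
  x \in @Gamma_pred R I J M <->
  forall p : prime_idealr R, (forall u, u \notin p -> u *: x <> 0) ->
    W_locus I J p.
Proof.
rewrite inE; split=> [xW p xp|xW p /Supp_cyclic]; last exact: xW.
by apply: xW; apply/Supp_cyclic.
Qed.

Lemma ideal_span (c : set R^o) : noetherian R ->
  c 0 -> (forall (a : R) u v, c u -> c v -> c (a *: u + v)) ->
  exists n (g : 'I_n -> R), (forall i, c (g i)) /\
    forall x, c x -> exists a : 'I_n -> R, x = \sum_(i < n) a i * g i.
Proof.
move=> noethR c0 cL.
pose S : {pred R^o} := [pred r | `[< c r >]].
have Sc : submod_closed S by split=> [|a u v]; rewrite !inE //; exact: cL.
have [n [g cE]] := noethR (HB.pack S (GRing.isSubmodClosed.Build R R^o S Sc)).
have cP x : c x <-> exists a : 'I_n -> R, x = \sum_(i < n) a i * g i.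
  have := congr1 (@^~ x) cE; rewrite /= inE => /propeqP cx.
  by rewrite cx; split=> [[a _ <-]|[a ->]]; exists a.
exists n, g; split=> [i|x /cP//]; apply/cP; exists (fun j => (j == i)%:R).
by rewrite (bigD1 i) //= eqxx mul1r big1 ?addr0 // => j /negPf->; rewrite mul0r.
Qed.

Lemma mem_spanned (c : set R^o) n (g a : 'I_n -> R) : c 0 ->
  (forall (a : R) u v, c u -> c v -> c (a *: u + v)) ->
  (forall i, c (g i)) -> c (\sum_(i < n) a i * g i).
Proof.
by move=> c0 cL cg; apply: (big_rec c) => // i y _ cy; exact: (cL (a i)).
Qed.

(** Let [g : a -> Q] be the map with graph [G], and let [c] be maximal among the
    ideals that contain [ker g] and meet [a] inside [ker g].  If [x] kills the
    image of [g], some power of [x] lies in [c].  Indeed, choose [n] such that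
    [(c : x ^+ n) = (c : x ^+ n.+1)]; then [c + (x ^+ n)] still meets [a] inside
    [ker g], so it is [c] by maximality. *)
Lemma radical_of_maximal_kernel (Q : lmodType R) (G : set (R^o * Q))
    (c : set R^o) (x : R) :
  noetherian R -> partial_linear G ->
  c 0 -> (forall (a : R) u v, c u -> c v -> c (a *: u + v)) ->
  (forall r, G (r, 0) -> c r) -> (forall r q, c r -> G (r, q) -> q = 0) ->
  (forall c' : set R^o, c `<=` c' ->
     (forall (a : R) u v, c' u -> c' v -> c' (a *: u + v)) ->
     (forall r q, c' r -> G (r, q) -> q = 0) -> c' `<=` c) ->
  (forall r q, G (r, q) -> x *: q = 0) ->
  exists n, c (x ^+ n).
Proof.
move=> noethR [G0 GL Gf] c0 cL Kc cG cmax xG.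
have cM (a r : R) : c r -> c (a * r).
  by move=> cr; have := cL a _ _ cr c0; rewrite addr0.
(* The increasing union of the colon ideals (c : x ^+ n) is finitely generated,
   hence reached at some n. *)
have [n xn] : exists n, forall r m, c (x ^+ m * r) -> c (x ^+ n * r).
  have up m k r : (m <= k)%N -> c (x ^+ m * r) -> c (x ^+ k * r).
    by move=> mk; rewrite -(subnK mk) exprD -mulrA; exact: cM.
  pose U : set R^o := [set r | exists m, c (x ^+ m * r)].
  have U0 : U 0 by exists 0; rewrite mulr0.
  have UL (a : R) u v : U u -> U v -> U (a *: u + v).
    move=> [k cu] [l cv]; exists (maxn k l).
    rewrite mulrDr mulrCA; apply: cL; first exact: (up k) (leq_maxl _ _) _.
    exact: (up l) (leq_maxr _ _) _.
  have [k [g [Ug Uspan]]] := ideal_span noethR U0 UL.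
  pose e i := sval (cid (Ug i)); exists (\max_(i < k) e i) => r m cr.
  have [|a ->] := Uspan r; first by exists m.
  rewrite mulr_sumr; under eq_bigr => i _ do rewrite mulrCA.
  apply: mem_spanned => // i; apply: (up (e i)); first exact: leq_bigmax.
  exact: (svalP (cid (Ug i))).
exists n; apply: (cmax [set r | exists y s, c y /\ r = y + s * x ^+ n :> R]).
- by move=> r cr; exists r, 0; rewrite mul0r addr0.
- move=> a _ _ [y [s [cy ->]]] [y' [s' [cy' ->]]].
  exists (a *: y + y' : R^o), (a * s + s'); split; first exact: cL.
  by rewrite scalerDr addrACA; congr (_ + _); rewrite mulrDl -mulrA.
- move=> _ q [y [s [cy ->]]] Gq; apply: cG (Gq).
  (* x times the element lies in the kernel, which c contains. *)
  have /Kc : G (x * (y + s * x ^+ n), 0).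
    by have := GL x _ _ Gq G0; rewrite addr0 -[x *: _]/(_, _) /= (xG _ _ Gq).
  rewrite mulrDr => cxy.
  have := cL (- 1) _ _ (cM x _ cy) cxy; rewrite scaleN1r addKr.
  rewrite mulrCA -exprS mulrC => /xn; rewrite mulrC => cs.
  by have := cL 1 _ _ cy cs; rewrite scale1r.
- by exists 0, 1; rewrite add0r mul1r.
Qed.

(** Baer's criterion reduces to maps on ideals.  The value at 1 of the extension
    found in [E] is torsion because its annihilator contains [c]. *)
Theorem Gamma_injective (E : lmodType R) :
  noetherian R -> injective_module E -> injective_module (Gamma I J E).
Proof.
move=> noethR injE; apply: baer => G pG; have [G0 GL Gf] := pG.
pose P (c : set R^o) :=
  [/\ c 0, forall (a : R) u v, c u -> c v -> c (a *: u + v) &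
      forall r q, c r -> G (r, q) -> q = 0].
have [|F [X0 FX0] FP Ftot|c [Kc [c0 cL cG] cmax]] :=
    @zorn_above _ P [set r | G (r, 0)].
- split=> [|a u v Gu Gv|r q Gr0 Grq] //=.
  + by have := GL a _ _ Gu Gv; rewrite -[a *: _ + _]/(_, _) /= scaler0 addr0.
  + exact: (partial_linear_fun pG Grq Gr0).
- split.
  + by exists X0 => //; case: (FP _ FX0).
  + move=> a u v [X FX Xu] [Y FY Yv]; case: (Ftot _ _ FX FY) => XY.
      by exists Y => //; case: (FP _ FY) => _ + _; apply=> //; exact: XY.
    by exists X => //; case: (FP _ FX) => _ + _; apply=> //; exact: XY.
  + by move=> r q [X FX Xr]; case: (FP _ FX) => _ _; apply.
(* The domain a of G is finitely generated, so a prime outside W_locus misses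
   some v killing the values of G, and the powers of v reach c. *)
have primeW (p : prime_idealr R) : (forall r, c r -> r \in p) -> W_locus I J p.
  move=> cp.
  pose a : set R^o := [set r | exists q, G (r, q)].
  have [n [g [ag aspan]]] : exists n (g : 'I_n -> R), (forall i, a (g i)) /\
      forall x, a x -> exists b : 'I_n -> R, x = \sum_(i < n) b i * g i.
    apply: ideal_span => //; first by exists 0.
    by move=> b u v [q Gu] [q' Gv]; exists (b *: q + q'); exact: (GL b _ _ Gu Gv).
  pose q i := sval (cid (ag i)).
  have Gq i : G (g i, q i) := svalP (cid (ag i)).
  apply: contrapT => nW.
  have qu i : exists u, u \notin p /\ u *: q i = 0.
    apply: contrapT => nu; apply: nW.
    have /mem_Gamma : val (q i) \in @Gamma_pred R I J E by exact: valP.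
    apply=> u up uq; apply: nu; exists u; split=> //.
    by apply: val_inj; rewrite linearZ.
  pose u i := sval (cid (qu i)).
  have up i : u i \notin p by case: (svalP (cid (qu i))).
  have uq i : u i *: q i = 0 by case: (svalP (cid (qu i))).
  pose v := \prod_i u i.
  have vp : v \notin p.
    rewrite /v; elim/big_ind: _ => // [|x y xp yp]; first by rewrite idealr1.
    by rewrite prime_idealrM negb_or xp.
  have [||k cvk] := @radical_of_maximal_kernel _ G c v noethR pG c0 cL Kc cG.
  - move=> c' cc' c'L c'G; apply: cmax => //; split=> //; exact: cc'.
  - move=> r q' Grq; have [|b rE] := aspan r; first by exists q'.
    have GE : G (\sum_i b i * g i, \sum_i b i *: q i).
      apply: (big_rec2 (fun (r : R) q => G (r : R^o, q))) => // i y y' _ Gy.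
      exact: (GL (b i) _ _ (Gq i) Gy).
    rewrite rE in Grq; rewrite (partial_linear_fun pG Grq GE) scaler_sumr.
    rewrite big1 // => i _.
    rewrite /v (bigD1 i) //= mulrC -scalerA [u i *: _]scalerA [u i * _]mulrC.
    by rewrite -scalerA uq !scaler0.
  - suff : v ^+ k \notin p by rewrite cp.
    elim: (k) => [|m IHm]; first by rewrite idealr1.
    by rewrite exprS prime_idealrM negb_or vp.
(* The map equal to G on its domain and to 0 on c; it is well defined by the
   choice of c. *)
pose G' : set (R^o * E) :=
  [set z | exists r q (k : R), [/\ G (r, q), c k & z = (r + k, val q)]].
have [g gP] : exists g : {linear R^o -> E}, forall r q, G' (r, q) -> g r = q.
  apply: injective_extend_graph => //; split.
  - by exists 0, 0, 0; split=> //; rewrite addr0.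
  - move=> a _ _ [r [q [k [Gq ck ->]]]] [r' [q' [k' [Gq' ck' ->]]]].
    exists (a *: r + r'), (a *: q + q'), (a *: (k : R^o) + k').
    split; [exact: (GL a _ _ Gq Gq')|exact: cL|].
    by rewrite linearP -[LHS]/(_, _) /= scalerDr addrACA.
  - move=> q' [r [q [k [Gq ck [/esym rk ->]]]]].
    rewrite (cG r q) ?linear0 //.
    have -> : r = (- 1) *: (k : R^o) + 0.
      by rewrite scaleN1r addr0; apply/eqP; rewrite -addr_eq0 rk.
    exact: cL.
have gE r : g r = r *: g 1.
  by rewrite -linearZ; congr (g _); rewrite /GRing.scale /= mulr1.
have cg k : c k -> k *: g 1 = 0.
  move=> ck; rewrite -gE; apply: gP.
  by exists 0, 0, k; split=> //; rewrite add0r.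
have gG : g 1 \in @Gamma_pred R I J E.
  apply/mem_Gamma => p pg; apply: primeW => r cr; apply: contraT => rp.
  by case: (pg r rp); exact: cg.
exists (mk_submod gG) => r q Gq; apply: val_inj; rewrite /= -gE; apply/esym/gP.
by exists r, q, 0; split=> //; rewrite addr0.
Qed.

End TorsionOfInjective.

(** * Linear functors and lifting to complexes of injectives *)

Section LinearFunctors.
Variables (R : comNzRingType) (F : linear_functor R).
Implicit Types M N P : lmodType R.

Lemma fmap_comp_eq M N P (g : {linear N -> P}) (f : {linear M -> N})
    (h : {linear M -> P}) :
  (forall x, g (f x) = h x) -> forall x, fmap F g (fmap F f x) = fmap F h x.
Proof.
move=> gf x; rewrite -[LHS]/((fmap F g \o fmap F f) x) -fmap_comp.
by congr (fmap F _ x); apply: linear_eq.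
Qed.

Lemma fmapD_eq M N (f g h : {linear M -> N}) :
  (forall x, f x + g x = h x) -> forall x, fmap F f x + fmap F g x = fmap F h x.
Proof.
move=> fgh x.
have -> : h = (1 \*: f \+ g : {linear M -> N}).
  by apply: linear_eq => y /=; rewrite scale1r fgh.
by rewrite fmap_linear /= scale1r.
Qed.

Lemma fmapB_eq M N (f g h : {linear M -> N}) :
  (forall x, f x - g x = h x) -> forall x, fmap F f x - fmap F g x = fmap F h x.
Proof.
move=> fgh x; rewrite -(@fmapD_eq _ _ h g f) ?addrK // => y.
by rewrite -fgh subrK.
Qed.

End LinearFunctors.

(** Statements on the cohomology of [F C] for every linear functor [F] specialize,
    for this one, to statements on the cohomology of [C] itself. *)
Definition id_functor (R : comNzRingType) : linear_functor R.
Proof. by exists id (fun M N f => f). Defined.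

Section Lifting.
Variable R : comNzRingType.

Record chain_map (C D : cochain R) := ChainMap {
  cmap :> forall n, {linear C n -> D n};
  cmapP : forall n x, cmap n.+1 (cdiff C n x) = cdiff D n (cmap n x)
}.

Definition injective_complex (D : cochain R) := forall n, injective_module (D n).

(** The usual step-by-step extension: the map built in degree [n] sends cocycles
    to cocycles, so its composite with the differential of [D] kills the kernel
    of the differential of [Q] and extends along it, because [D n.+1] is
    injective. *)
Lemma lift_resolution (A : lmodType R) (Q : injective_resolution A)
    (D : cochain R) (i : {linear A -> D 0%N}) :
  injective_complex D -> (forall a, cdiff D 0 (i a) = 0) ->
  exists f : chain_map Q D, forall a, f 0%N (ires_aug Q a) = i a.
Proof.
move=> injD di.
pose ok n (f : {linear Q n -> D n}) :=
  forall x, cdiff Q n x = 0 -> cdiff D n (f x) = 0.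
have [|f0 f0P] := injective_extend (f := i) (i := ires_aug Q) (injD 0%N).
  move=> a; rewrite -[0](linear0 (ires_aug Q)) => /ires_aug_inj->.
  by rewrite linear0.
have ok0 : ok 0%N f0 by move=> x /ires_exact0[a ->]; rewrite f0P.
have step n (f : {f | ok n f}) :
    {g | ok n.+1 g /\ forall x, g (cdiff Q n x) = cdiff D n (sval f x)}.
  apply: cid; case: f => f fP /=.
  have [g gP] := injective_extend (f := cdiff D n \o f) (injD n.+1) fP.
  exists g; split=> // x /ires_exact[y ->]; rewrite gP /=.
  exact: cdiff_cdiff.
pose fs := nat_rect (fun n => {f | ok n f}) (exist _ f0 ok0)
  (fun n f => exist _ (sval (step n f)) (proj1 (svalP (step n f)))).
unshelve eexists (@ChainMap _ _ (fun n => sval (fs n)) _) => //.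
by move=> n x; case: (svalP (step n (fs n))).
Qed.

End Lifting.

(** * The cocone of a chain map *)

Section Cocone.
Variables (R : comNzRingType) (C D : cochain R) (f : chain_map C D).

(** The mapping cone of [f], shifted by one so that it starts in degree 0: the
    component from [D] sits one degree above its own. *)
Definition cocone_obj (n : nat) : lmodType R :=
  if n is m.+1 then (C m.+1 * D m)%type : lmodType R else C 0%N.

Definition cocone_diff n : cocone_obj n -> cocone_obj n.+1 :=
  match n with
  | 0 => fun x => (cdiff C 0 x, f 0%N x)
  | m.+1 => fun z => (cdiff C m.+1 z.1, f m.+1 z.1 - cdiff D m z.2)
  end.

Fact cocone_diff_linear n : linear (@cocone_diff n).
Proof.
case: n => [|n] a x y; rewrite /= !linearP //.
by rewrite addrACA -scalerDr.
Qed.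

Fact cocone_diff_diff n (x : cocone_obj n) :
  cocone_diff (cocone_diff x) = 0.
Proof.
case: n x => [|n] x /=; first by rewrite cdiff_cdiff cmapP subrr.
by rewrite cdiff_cdiff cmapP linearB cdiff_cdiff subr0 subrr.
Qed.

Definition cocone : cochain R :=
  @Cochain R cocone_obj (fun n => mk_linear (@cocone_diff_linear n))
    cocone_diff_diff.

Lemma cocone_injective :
  injective_complex C -> injective_complex D -> injective_complex cocone.
Proof. by move=> injC injD [|n]; [exact: injC | exact: injective_prod]. Qed.

(** The lemmas below are the pieces in use of the long exact sequence
    [H^n K -> H^n C -> H^n D -> H^(n+1) K -> H^(n+1) C], where [K] is the
    cocone. *)
Lemma cocone_exactSS n :
  exact_at C n.+2 -> exact_at D n.+1 -> exact_at cocone n.+2.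
Proof.
move=> exC exD [x y] /= [dx /eqP]; rewrite subr_eq0 => /eqP fxy.
have [u xE] := exC x dx; have [|v vE] := exD (f n.+1 u - y).
  by rewrite linearB /= -cmapP -xE fxy subrr.
by exists (u, v); rewrite /= -xE -vE opprB addrCA subrr addr0.
Qed.

Lemma cocone_iso n :
  exact_at cocone n -> exact_at cocone n.+1 ->
  module_iso (cohomology C n) (cohomology D n).
Proof.
move=> ex0 ex1; apply: (@cohomology_iso R _ _ _ _ (f n)).
- by move=> x dx; rewrite -cmapP dx linear0.
- move=> x dx; split; last first.
    case: n {ex0 ex1} x dx => [|n] x _ /= => [->|[y ->]]; first by rewrite linear0.
    by exists (f n y); rewrite cmapP.
  case: n {ex1} ex0 x dx => [|n] ex0 x dx /= => [fx|[y fxy]].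
    by apply: ex0; rewrite /= dx fx.
  have /= [|u uE] := ex0 (x, y); first by rewrite dx fxy subrr.
  by case: n x y u uE {ex0 fxy dx} => [|n] /= x y u [-> _]; [exists u|exists u.1].
- move=> y dy; have /= [|u uE] := ex1 (0, y).
    by rewrite !linear0 dy subr0.
  case: n y {ex0 ex1 dy} u uE => [|n] y /= u [/esym du ->].
    by exists u => //=; rewrite subrr.
  by exists u.1 => //=; exists u.2; rewrite subKr.
Qed.

(** Injectivity of [H^n D -> H^(n+1) K] when [H^n C = 0]. *)
Lemma cocone_coboundary n (y : D n) :
  exact_at C n -> is_coboundary ((0, y) : cocone n.+1) -> is_coboundary y.
Proof.
case: n y => [|n] y exC /= [u [/esym du ->]].
  by rewrite (exC u du) linear0.
have [v ->] := exC _ du; exists (f n v - u.2).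
by rewrite linearB /= cmapP.
Qed.

Lemma cocone_exact_target n :
  exact_at C n -> exact_at cocone n.+1 -> exact_at D n.
Proof.
move=> exC exK y dy; apply: cocone_coboundary => //; apply: exK.
by rewrite /= !linear0 dy subr0.
Qed.

Lemma cocone_shift n :
  exact_at C n -> exact_at C n.+1 ->
  module_iso (cohomology D n) (cohomology cocone n.+1).
Proof.
move=> ex0 ex1.
have li : linear (fun y : D n => (0, y) : cocone n.+1).
  by move=> a x y; rewrite -[RHS]/(_, _) /= scaler0 addr0.
apply: (@cohomology_iso R _ _ _ _ (mk_linear li)).
- by move=> y dy; rewrite /= !linear0 dy subr0.
- move=> y dy; split=> /=; first exact: cocone_coboundary.
  case: n y {ex0 ex1 li dy} => [y ->|n y [v ->]] /=.
    by exists 0; rewrite !linear0.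
  by exists (0, - v); rewrite /= !linear0 linearN opprK add0r.
- move=> [x y] /= [dx /eqP]; rewrite subr_eq0 => /eqP fxy.
  have [u xE] := ex1 x dx; exists (y - f n u) => /=.
    by rewrite linearB /= -fxy -cmapP -xE subrr.
  have -> : (0, y - f n u) - (x, y) = (- cdiff C n u, - f n u) :> cocone n.+1.
    by rewrite -[LHS]/(_ - _, _ - _) xE sub0r addrAC subrr sub0r.
  case: n u x y {ex0 ex1 dx li fxy xE} => [|n] u x y /=.
    by exists (- u); rewrite !linearN.
  by exists (- u, 0); rewrite /= !linearN linear0 subr0.
Qed.

End Cocone.

(** * Linear functors on complexes *)

Section ChainIsomorphisms.
Variable R : comNzRingType.

Lemma chain_iso_cohomology (C D : cochain R) (f : chain_map C D) n :
  (forall k, bijective (f k)) -> module_iso (cohomology C n) (cohomology D n).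
Proof.
move=> bf; have injf k := bij_inj (bf k).
have surjf k y : exists x, f k x = y.
  by have [g _ gK] := bf k; exists (g y).
apply: (@cohomology_iso R _ _ _ _ (f n)).
- by move=> x dx; rewrite -cmapP dx linear0.
- move=> x _; split.
    case: n x => [|n] x /= => [fx|[y fx]].
      by apply: (injf 0%N); rewrite fx linear0.
    have [u uy] := surjf n y; exists u; apply: (injf n.+1).
    by rewrite fx -uy cmapP.
  case: n x => [|n] x /= => [->|[y ->]]; first by rewrite linear0.
  by exists (f n y); rewrite cmapP.
- move=> y dy; have [x xE] := surjf n y; exists x.
    by apply: (injf n.+1); rewrite cmapP xE dy linear0.
  by rewrite xE subrr; case: n {y dy x xE} => [|n] //=; exists 0; rewrite linear0.
Qed.

Lemma cohomology_id_functor (C : cochain R) n :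
  module_iso (cohomology (fmap_cochain (id_functor R) C) n) (cohomology C n).
Proof.
have fP k (x : C k) : cdiff C k x = cdiff C k x by [].
apply: (chain_iso_cohomology (f := @ChainMap _ (fmap_cochain (id_functor R) C) C
  (fun k => idfun : {linear C k -> C k}) fP)) => k.
by exists id.
Qed.

Variable F : linear_functor R.

Fact fmap_chain_subproof (C D : cochain R) (f : chain_map C D) n x :
  fmap F (f n.+1) (cdiff (fmap_cochain F C) n x) =
  cdiff (fmap_cochain F D) n (fmap F (f n) x).
Proof.
rewrite (fmap_comp_eq (h := f n.+1 \o cdiff C n)) //.
by rewrite (fmap_comp_eq (h := f n.+1 \o cdiff C n)) // => y /=; rewrite cmapP.
Qed.

Definition fmap_chain (C D : cochain R) (f : chain_map C D) :
  chain_map (fmap_cochain F C) (fmap_cochain F D) :=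
  @ChainMap _ (fmap_cochain F C) (fmap_cochain F D) (fun n => fmap F (f n))
    (@fmap_chain_subproof C D f).

(** An additive functor preserves finite products, because these are described by
    equations between the projections and the injections. *)
Lemma fmap_prod_bij (U V : lmodType R) :
  bijective (fun z : F (U * V)%type =>
    (fmap F (fst : {linear _ -> U}) z, fmap F (snd : {linear _ -> V}) z)).
Proof.
have ll : linear (fun x : U => (x, 0) : (U * V)%type).
  by move=> a x y; rewrite -[RHS]/(_, _) /= scaler0 addr0.
have lr : linear (fun x : V => (0, x) : (U * V)%type).
  by move=> a x y; rewrite -[RHS]/(_, _) /= scaler0 addr0.
exists (fun w => fmap F (mk_linear ll) w.1 + fmap F (mk_linear lr) w.2).
  move=> z /=.
  rewrite (fmap_comp_eq
    (h := mk_linear ll \o (fst : {linear (U * V)%type -> U}))) //.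
  rewrite (fmap_comp_eq
    (h := mk_linear lr \o (snd : {linear (U * V)%type -> V}))) //.
  rewrite (fmapD_eq (h := idfun)) ?fmap_id // => -[x y] /=.
  by rewrite -[LHS]/(_, _) /= addr0 add0r.
move=> [x y]; congr pair => /=; rewrite linearD /=.
  rewrite (fmap_comp_eq (h := idfun)) // fmap_id.
  by rewrite (fmap_comp_eq (h := \0)) // (@fmap0 _ F) // addr0.
rewrite (fmap_comp_eq (h := \0)) // (@fmap0 _ F) // add0r.
by rewrite (fmap_comp_eq (h := idfun)) // fmap_id.
Qed.

Lemma fmap_cocone (C D : cochain R) (f : chain_map C D) n :
  module_iso (cohomology (fmap_cochain F (cocone f)) n)
             (cohomology (cocone (fmap_chain f)) n).
Proof.
pose g k : F (cocone f k) -> cocone (fmap_chain f) k :=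
  match k return F (cocone f k) -> cocone (fmap_chain f) k with
  | 0 => id
  | m.+1 => fun z => (fmap F (fst : {linear _ -> C m.+1}) z,
                      fmap F (snd : {linear _ -> D m}) z)
  end.
have lg k : linear (g k).
  by case: k => [|k] a x y //=; rewrite !linearP.
have gP k x : mk_linear (lg k.+1) (cdiff (fmap_cochain F (cocone f)) k x) =
    cdiff (cocone (fmap_chain f)) k (mk_linear (lg k) x).
  case: k x => [|k] x /=; congr pair.
  - by rewrite (fmap_comp_eq (h := cdiff C 0)).
  - by rewrite (fmap_comp_eq (h := f 0%N)).
  - rewrite (fmap_comp_eq (h := cdiff C k.+1 \o fst)) //.
    by rewrite (fmap_comp_eq (h := cdiff C k.+1 \o fst)).
  - rewrite [LHS](fmap_comp_eq (h := (f k.+1 \o fst) \- (cdiff D k \o snd))) //.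
    rewrite (fmap_comp_eq (g := f k.+1) (h := f k.+1 \o fst)) //.
    rewrite (fmap_comp_eq (g := cdiff D k) (h := cdiff D k \o snd)) //.
    exact/esym/fmapB_eq.
apply: (chain_iso_cohomology (f := @ChainMap _ (fmap_cochain F (cocone f))
  (cocone (fmap_chain f)) (fun k => mk_linear (lg k)) gP)) => -[|k] /=.
  by exists id.
exact: fmap_prod_bij.
Qed.

End ChainIsomorphisms.

(** * Splitting off the bottom term *)

Section Truncation.
Variables (R : comNzRingType) (C : cochain R) (T0 : lmodType R).
Variables (j : {linear T0 -> C 1%N}) (p : {linear C 1%N -> T0}).
Variable (r : {linear C 1%N -> C 0%N}).
Hypotheses (jK : cancel j p) (dK : cancel (cdiff C 0) r).
Hypothesis jp : forall x, j (p x) + cdiff C 0 (r x) = x.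

(** The summand [C 0] of [C 1] is split off: [T0] is a complement of the image of
    the first differential, and all degrees drop by one. *)
Definition trunc_obj (n : nat) : lmodType R := if n is m.+1 then C m.+2 else T0.

Definition trunc_diff n : {linear trunc_obj n -> trunc_obj n.+1} :=
  match n with
  | 0 => cdiff C 1 \o j
  | m.+1 => cdiff C m.+2
  end.

Fact trunc_diff_diff n (x : trunc_obj n) : trunc_diff n.+1 (trunc_diff n x) = 0.
Proof. by case: n x => [|n] x; exact: cdiff_cdiff. Qed.

Definition trunc : cochain R := @Cochain R trunc_obj trunc_diff trunc_diff_diff.

Lemma trunc_injective : injective_complex C -> injective_complex trunc.
Proof.
move=> injC [|n]; last exact: injC.
exact: injective_retract jK (injC 1%N).
Qed.

Definition trunc_incl n : {linear trunc n -> C n.+1} :=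
  match n with
  | 0 => j
  | m.+1 => idfun
  end.

Variable F : linear_functor R.

(** A functor keeps split monomorphisms injective. *)
Lemma fmap_trunc_exact0 : exact_at (fmap_cochain F C) 0.
Proof.
move=> x /= dx; rewrite -[x](fmap_id (l := F)).
by rewrite -(fmap_comp_eq (f := cdiff C 0) (g := r)) // dx linear0.
Qed.

Lemma fmap_trunc n :
  module_iso (cohomology (fmap_cochain F trunc) n)
             (cohomology (fmap_cochain F C) n.+1).
Proof.
have rj x : r (j x) = 0.
  have := jp (j x); rewrite jK => /(canRL (addKr _)); rewrite addNr.
  by move/(congr1 r); rewrite dK linear0.
have Fj x : fmap F r (fmap F j x) = 0.
  by rewrite (fmap_comp_eq (h := \0)) // (@fmap0 _ F).
have FjK x : fmap F p (fmap F j x) = x.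
  by rewrite (fmap_comp_eq (h := idfun)) // fmap_id.
have Fjp x : fmap F j (fmap F p x) + fmap F (cdiff C 0) (fmap F r x) = x.
  rewrite (fmap_comp_eq (h := j \o p)) // (fmap_comp_eq (h := cdiff C 0 \o r)) //.
  by rewrite (fmapD_eq (h := idfun)) // fmap_id.
have FdK x : fmap F r (fmap F (cdiff C 0) x) = x.
  by rewrite (fmap_comp_eq (h := idfun)) // fmap_id.
have Fdj x : fmap F (cdiff C 1) (fmap F j x) = fmap F (trunc_diff 0) x.
  exact: fmap_comp_eq.
have Fdd (x : F (C 0%N)) : fmap F (cdiff C 1) (fmap F (cdiff C 0) x) = 0.
  exact: (cdiff_cdiff (c := fmap_cochain F C)).
apply: (@cohomology_iso R (fmap_cochain F trunc) (fmap_cochain F C) n n.+1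
  (fmap F (trunc_incl n))).
- by case: n => [|n] x /= dx; rewrite ?Fdj ?fmap_id.
- case: n => [|[|n]] x _ /=; rewrite ?fmap_id.
  + split=> [[y xy]|->]; last by exists 0; rewrite !linear0.
    by rewrite -[x]FjK xy -[y]FdK -xy Fj !linear0.
  + split=> -[y ->]; last by exists (fmap F j y); rewrite Fdj.
    exists (fmap F p y); rewrite -Fdj.
    by rewrite -[y in LHS]Fjp linearD /= Fdd addr0.
  + by [].
- case: n => [|n] y /= dy; last first.
    by exists y; rewrite //= fmap_id subrr; exists 0; rewrite linear0.
  exists (fmap F p y).
    by rewrite -Fdj -dy -[y in RHS]Fjp linearD /= Fdd addr0.
  by exists (- fmap F r y); rewrite linearN -{2}[y]Fjp opprD addrA subrr sub0r.
Qed.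

End Truncation.

Lemma exact_truncation (R : comNzRingType) (C : cochain R) :
  injective_complex C -> exact_at C 0 ->
  exists2 T : cochain R, injective_complex T &
    forall F : linear_functor R, exact_at (fmap_cochain F C) 0 /\
      forall n, module_iso (cohomology (fmap_cochain F T) n)
                           (cohomology (fmap_cochain F C) n.+1).
Proof.
move=> injC ex0.
have [r rK] := injective_extend (f := idfun) (injC 0%N) ex0.
pose j : {linear submod (ker_pred r) -> C 1%N} := val.
have pP x : x - cdiff C 0 (r x) \in ker_pred r.
  by rewrite inE linearB /= rK subrr.
have lp : linear (fun x => mk_submod (pP x)).
  move=> a x y; apply: val_inj => /=.
  by rewrite !linearP addrACA -scalerDr.
have jK : cancel j (mk_linear lp).
  move=> [x xr]; apply: val_inj => /=; move: (xr); rewrite inE => /eqP->.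
  by rewrite linear0 subr0.
have jp x : j (mk_linear lp x) + cdiff C 0 (r x) = x by rewrite /= subrK.
exists (trunc j); first exact: trunc_injective jK injC.
move=> F; split; first exact: fmap_trunc_exact0 rK F.
exact: fmap_trunc jK rK jp F.
Qed.

(** * Removing the bottom cohomology module *)

Section Peeling.
Variable R : comNzRingType.

Lemma exact_at_iso (C D : cochain R) m n :
  module_iso (cohomology C m) (cohomology D n) -> exact_at C m -> exact_at D n.
Proof. by move=> iso /exact_atP/(zero_module_iso iso)/exact_atP. Qed.

Lemma truncation_cohomology (C T : cochain R) n :
  (forall F : linear_functor R, exact_at (fmap_cochain F C) 0 /\
      forall n, module_iso (cohomology (fmap_cochain F T) n)
                           (cohomology (fmap_cochain F C) n.+1)) ->
  module_iso (cohomology T n) (cohomology C n.+1).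
Proof.
move=> /(_ (id_functor R)) [_ /(_ n) iso].
apply: module_iso_trans (module_iso_sym (cohomology_id_functor T n)) _.
exact: module_iso_trans iso (cohomology_id_functor C n.+1).
Qed.

(** A bounded below exact complex of injectives is contractible, so any additive
    functor keeps it exact.  Truncating repeatedly avoids writing the
    contraction. *)
Lemma fmap_exact (F : linear_functor R) (C : cochain R) :
  injective_complex C -> (forall n, exact_at C n) ->
  forall n, exact_at (fmap_cochain F C) n.
Proof.
move=> injC exC n; elim: n C injC exC => [|n IHn] C injC exC.
  by have [T _ /(_ F)[]] := exact_truncation injC (exC 0%N).
have [T injT TP] := exact_truncation injC (exC 0%N).
have [_ isoT] := TP F; apply: exact_at_iso (isoT n) _; apply: IHn => // k.
by apply: exact_at_iso (exC k.+1); apply/module_iso_sym/truncation_cohomology.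
Qed.

Lemma resolution_exact (A : lmodType R) (Q : injective_resolution A) n :
  exact_at Q n.+1.
Proof. by move=> x /ires_exact. Qed.

(** The cocone of a resolution of [H^0 D] mapping to [D] has no cohomology in
    degrees 0 and 1: [f] induces an isomorphism on [H^0], and [H^1] of the
    resolution is 0. *)
Lemma cocone_lift_exact (A : lmodType R) (Q : injective_resolution A)
    (D : cochain R) (i : {linear A -> D 0%N}) (f : chain_map Q D) :
  injective i -> (forall x, cdiff D 0 x = 0 -> exists a, x = i a) ->
  (forall a, f 0%N (ires_aug Q a) = i a) ->
  exact_at (cocone f) 0 /\ exact_at (cocone f) 1.
Proof.
move=> inji imi fi; split.
  move=> x /= [dx fx]; have /ires_exact0[a xa] := dx.
  move: fx; rewrite xa fi -[RHS](linear0 i) => /inji->.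
  by rewrite linear0.
move=> [x y] /= [/ires_exact[u xu] /eqP]; rewrite subr_eq0 => /eqP fxy.
have [|a ya] := imi (y - f 0%N u); first by rewrite linearB /= -fxy xu cmapP subrr.
exists (u + ires_aug Q a); rewrite !linearD /= fi -ya xu [f 0%N u + _]addrC subrK.
have /ires_exact0-> : exists m, ires_aug Q a = ires_aug Q m by exists a.
by rewrite addr0.
Qed.

(** A lift of an isomorphism to the resolutions has an exact cocone, which [F]
    keeps exact. *)
Lemma right_derived_iso (F : linear_functor R) (A B : lmodType R) n :
  module_iso A B -> module_iso (right_derived F (Posz n) A)
                               (right_derived F (Posz n) B).
Proof.
move=> [e be]; pose Q := std_resolution A; pose Q' := std_resolution B.
pose i : {linear A -> Q' 0%N} := ires_aug Q' \o e.
have di a : cdiff Q' 0 (i a) = 0 by apply/ires_exact0; exists (e a).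
have [f fi] := lift_resolution Q (@ires_injective _ _ Q') di.
have [||ex0 ex1] := cocone_lift_exact (i := i) (f := f) _ _ fi.
- by move=> x y /ires_aug_inj/(bij_inj be).
- have [g _ gK] := be => x /ires_exact0[b ->].
  by exists (g b); rewrite /= gK.
have exK k : exact_at (fmap_cochain F (cocone f)) k.
  apply: fmap_exact => [|[|[|l]]] //.
    by apply: cocone_injective; apply: ires_injective.
  by apply: cocone_exactSS; apply: resolution_exact.
apply: (cocone_iso (f := fmap_chain F f)); apply: exact_at_iso (exK _);
  exact: fmap_cocone.
Qed.

Lemma cohomology0_incl (D : cochain R) :
  exists2 i : {linear cohomology D 0 -> D 0%N}, injective i &
    forall x, cdiff D 0 x = 0 <-> exists a, x = i a.
Proof.
have rep (u : cohomology D 0) := cid (quot_pi_surj u).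
pose i u : D 0%N := val (sval (rep u)).
have iE z : i (quot_pi (@coboundaries R D 0) z) = val z.
  rewrite /i; case: (rep _) => z' /= /quot_piP; rewrite inE /= => /eqP.
  by rewrite subr_eq0 => /eqP.
have li : linear i.
  move=> a u v; have [x ->] := quot_pi_surj u; have [y ->] := quot_pi_surj v.
  by rewrite -linearP !iE linearP.
exists (mk_linear li) => [u v|x] /=.
  have [y ->] := quot_pi_surj u; have [z ->] := quot_pi_surj v.
  by rewrite !iE => /val_inj->.
split=> [dx|[u ->]].
  have xZ : x \in cocycles D 0 by rewrite mem_cocycles dx.
  by exists (quot_pi _ (mk_submod xZ)); rewrite iE.
have [[z zZ] ->] := quot_pi_surj u; rewrite iE /=.
by apply/eqP; rewrite -mem_cocycles.
Qed.

(** One step of the dismantling of [D]: [T] carries the cohomology of [D] but for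
    [H^0 D], and [F T] is, up to a shift by two, the cocone of the map from
    [F Q] to [F D], where [Q] resolves [H^0 D].  The cocone is part of
    the statement because the lemmas on cocones then yield every piece of the
    long exact sequence. *)
Lemma peel (D : cochain R) : injective_complex D ->
  exists (f : chain_map (std_resolution (cohomology D 0)) D) (T : cochain R),
    [/\ injective_complex T,
        forall n, module_iso (cohomology D n.+1) (cohomology T n) &
        forall F : linear_functor R, let K := cocone (fmap_chain F f) in
          [/\ exact_at K 0, exact_at K 1 &
              forall n, module_iso (cohomology K n.+2)
                                   (cohomology (fmap_cochain F T) n)]].
Proof.
move=> injD; have [i inji imi] := cohomology0_incl D.
set Q := std_resolution _.
have di a : cdiff D 0 (i a) = 0 by apply/imi; exists a.
have [f fi] := lift_resolution Q injD di.
have [ex0 ex1] := cocone_lift_exact inji (fun x => proj1 (imi x)) fi.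
have injK : injective_complex (cocone f).
  by apply: cocone_injective => //; exact: ires_injective.
have [T1 injT1 T1P] := exact_truncation injK ex0.
have ex1' : exact_at T1 0.
  by apply: exact_at_iso ex1; apply/module_iso_sym/truncation_cohomology.
have [T injT TP] := exact_truncation injT1 ex1'.
exists f, T; split=> // [n|F K].
  apply: module_iso_trans (cocone_shift f _ _) _; try exact: resolution_exact.
  apply: module_iso_sym; apply: module_iso_trans (truncation_cohomology n TP) _.
  exact: truncation_cohomology n.+1 T1P.
have [exK0 isoK] := T1P F; have [exT0 isoT] := TP F.
have KE n : module_iso (cohomology (fmap_cochain F (cocone f)) n) (cohomology K n).
  exact: fmap_cocone.
split=> [||n]; first exact: exact_at_iso (KE 0%N) exK0.
  by apply: exact_at_iso (KE 1%N) _; apply: exact_at_iso (isoK 0%N) exT0.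
apply: module_iso_sym; apply: module_iso_trans (isoT n) _.
exact: module_iso_trans (isoK n.+1) (KE n.+2).
Qed.

End Peeling.

Section HyperDerived.
Variables (R : comNzRingType) (F : linear_functor R).

Local Notation RF n A := (right_derived F (Posz n) A).

Lemma derived_zero_iso n (A B : lmodType R) :
  module_iso A B -> zero_module (RF n A) -> zero_module (RF n B).
Proof. by move=> iso; apply: zero_module_iso; apply: right_derived_iso. Qed.

(** By induction on [n], both neighbours of [H^n (F D)] in the long exact sequence
    of [peel] vanish. *)
Lemma hyperderived_vanish n (D : cochain R) :
  injective_complex D ->
  (forall i, (i <= n)%N -> zero_module (RF (n - i) (cohomology D i))) ->
  exact_at (fmap_cochain F D) n.
Proof.
elim: n D => [|n IHn] D injD h;
  have [f [T [injT TD /(_ F)/= [ex0 ex1 KT]]]] := peel injD.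
  apply: cocone_exact_target ex1; apply/exact_atP.
  exact: (h 0%N).
apply: (cocone_exact_target (f := fmap_chain F f)).
  by apply/exact_atP; have := h 0%N isT; rewrite subn0.
apply: exact_at_iso (module_iso_sym (KT n)) _; apply: IHn => // i lein.
apply: derived_zero_iso (TD i) _.
exact: (h i.+1).
Qed.

(** The pieces below [t] are removed by induction, each removal being an
    isomorphism by the first two families of hypotheses.  Once [t = 0], the
    remaining piece is the bottom one, and [R^s F (H^0 D)] differs from
    [H^s (F D)] by the cohomology of [F T] in degrees [s - 2] and [s - 1], which
    vanishes by the first and the third families. *)
Theorem hyperderived_collapse s t (D : cochain R) :
  injective_complex D ->
  (forall i, i != t -> (i <= s + t)%N ->
     zero_module (RF (s + t - i) (cohomology D i))) ->
  (forall i, (i < t)%N -> zero_module (RF (s + t + 1 - i) (cohomology D i))) ->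
  (forall i, (t < i)%N -> (i < s + t)%N ->
     zero_module (RF (s + t - 1 - i) (cohomology D i))) ->
  module_iso (RF s (cohomology D t)) (cohomology (fmap_cochain F D) (s + t)).
Proof.
elim: t D => [|t IHt] D injD h0 h1 h2;
  have [f [T [injT TD /(_ F)/= [ex0 ex1 KT]]]] := peel injD.
  rewrite addn0 in h0 h2 *.
  (* The cocone of [F f] has to be exact in degrees s and s.+1. *)
  have exT m : (m.+1 <= s <= m.+2)%N -> exact_at (fmap_cochain F T) m.
    move=> /andP[ms sm]; apply: hyperderived_vanish => // i im.
    apply: derived_zero_iso (TD i) _.
    have [sE|sE] : s = m.+1 \/ s = m.+2 by lia.
      have -> : (m - i = s - i.+1)%N by lia.
      by apply: h0 => //; lia.
    have -> : (m - i = s - 1 - i.+1)%N by lia.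
    by apply: h2 => //; lia.
  apply: (cocone_iso (f := fmap_chain F f));
    case: s exT {h0 h1 h2} => [|[|s]] exT //.
  - by apply: exact_at_iso (module_iso_sym (KT _)) _; apply: exT; lia.
  - by apply: exact_at_iso (module_iso_sym (KT _)) _; apply: exT; lia.
  - by apply: exact_at_iso (module_iso_sym (KT _)) _; apply: exT; lia.
apply: module_iso_trans (right_derived_iso F s (TD t)) _.
apply: module_iso_trans (IHt T injT _ _ _) _.
- move=> i it ist; apply: derived_zero_iso (TD i) _.
  have := h0 i.+1; rewrite eqSS it addnS subSS ltnS; exact.
- move=> i it; apply: derived_zero_iso (TD i) _.
  have := h1 i.+1 it.
  by rewrite (_ : (s + t.+1 + 1 - i.+1 = s + t + 1 - i)%N); last lia.
- move=> i it ist; apply: derived_zero_iso (TD i) _.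
  have := h2 i.+1; rewrite !ltnS addnS ltnS => /(_ it ist).
  by rewrite (_ : ((s + t).+1 - 1 - i.+1 = s + t - 1 - i)%N); last lia.
apply: module_iso_sym; rewrite addnS; apply: module_iso_trans (KT _).
apply: (cocone_shift (fmap_chain F f)); apply/exact_atP.
  by have := h0 0%N isT isT; rewrite subn0 addnS.
by have := h1 0%N isT; rewrite subn0 addn1 addnS.
Qed.

End HyperDerived.

(** * Homomorphisms from a torsion module *)

Section TorsionHom.
Variables (R : comNzRingType) (I J : ideal R).

Lemma right_derived_zero (F : linear_functor R) (A : lmodType R) (i : int) :
  zero_module A -> zero_module (right_derived F i A).
Proof.
case: i => n A0; last exact: zero_rV0.
apply/exact_atP/fmap_exact => [|[|k]]; first exact: ires_injective.
  by move=> x /ires_exact0[a ->]; rewrite (A0 a) linear0.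
exact: resolution_exact.
Qed.

(** A linear map carries torsion elements to torsion elements. *)
Lemma torsion_hom_bij (N E : lmodType R) : torsion I J N ->
  bijective (hom_map (N := N) (val : {linear Gamma I J E -> E})).
Proof.
move=> torsN.
have hG (h : Hom N E) x : val h x \in @Gamma_pred R I J E.
  have xG : x \in @Gamma_pred R I J N by have : [set: N] x by []; rewrite -torsN.
  exact: (Gamma_map_subproof (mk_linear (Hom_linear h)) (mk_submod xG)).
have hL (h : Hom N E) :
    (fun x => mk_submod (hG h x)) \in @hom_pred R N (Gamma I J E).
  by rewrite inE => a x y; apply: val_inj; rewrite /= Hom_linear.
exists (fun h => mk_submod (hL h)) => h; apply/val_inj/funext => x //.
exact: val_inj.
Qed.

Lemma torsion_hom_cohomology (N : lmodType R) (C : cochain R) n :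
  torsion I J N ->
  module_iso
    (cohomology (fmap_cochain (hom_functor N)
                              (fmap_cochain (Gamma_functor I J) C)) n)
    (cohomology (fmap_cochain (hom_functor N) C) n).
Proof.
move=> torsN; set CG := fmap_cochain (Gamma_functor I J) C.
pose g k : {linear hom_functor N (CG k) -> hom_functor N (C k)} :=
  mk_linear (hom_map_linear (N := N) (val : {linear Gamma I J (C k) -> C k})).
have gP k h : g k.+1 (cdiff (fmap_cochain (hom_functor N) CG) k h) =
    cdiff (fmap_cochain (hom_functor N) C) k (g k h).
  exact/val_inj/funext.
apply: (chain_iso_cohomology (f := @ChainMap _ (fmap_cochain (hom_functor N) CG)
  (fmap_cochain (hom_functor N) C) g gP)) => k.
exact: torsion_hom_bij.
Qed.

End TorsionHom.

Theorem theorem3p1 (R : comNzRingType) (noethR : noetherian R)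
    (I J : ideal R) (M : lmodType R) (s t : int)
    (N : lmodType R) (torsN : torsion I J N)
    (h0 : forall i : int, i != t -> i <= s + t ->
      zero_module (Ext (s + t - i) N (local_cohomology I J i M)))
    (h1 : forall i : int, i < t ->
      zero_module (Ext (s + t + 1 - i) N (local_cohomology I J i M)))
    (h2 : forall i : int, t < i -> i < s + t ->
      zero_module (Ext (s + t - 1 - i) N (local_cohomology I J i M))) :
  module_iso (Ext s N (local_cohomology I J t M)) (Ext (s + t) N M).
Proof.
pose D := fmap_cochain (Gamma_functor I J) (std_resolution M).
have injD : injective_complex D.
  by move=> n; apply: Gamma_injective => //; apply: ires_injective.
have isoD n := torsion_hom_cohomology (std_resolution M) n torsN.
(* When s or t is negative, the piece that may survive is itself 0, and all the
   pieces of total degree s + t vanish. *)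
have iso_neg : (s < 0) || (t < 0) ->
    module_iso (Ext s N (local_cohomology I J t M)) (Ext (s + t) N M).
  move=> st0; apply: module_iso_zero.
    case: (s) st0 => [n|n _]; last exact: zero_rV0.
    by case: (t) => // m _; apply: right_derived_zero => //; exact: zero_rV0.
  case st: (s + t) => [n|k]; last exact: zero_rV0.
  apply: zero_module_iso (isoD n) _.
  apply/exact_atP/hyperderived_vanish => // i lein.
  have := h0 (Posz i); rewrite st subzn //; apply=> //.
  by apply: contraL st0; lia.
case: s t iso_neg h0 h1 h2 => [s|s] [t|t] iso_neg h0 h1 h2; try exact: iso_neg.
apply: module_iso_trans (isoD (s + t)%N); apply: hyperderived_collapse => //.
- by move=> i it ist; have := h0 (Posz i) it ist; rewrite -PoszD subzn.
- move=> i it; have := h1 (Posz i) it; rewrite -!PoszD subzn //; lia.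
- move=> i it ist; have := h2 (Posz i) it ist; rewrite -PoszD !subzn //; lia.
Qed.
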